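(* Let $X=(X_t)_{t\ge0}$ be a càdlàg process satisfying $\mathbb E[\sup_{0\le s\le t}|X_s|]<\infty$ for all $t\ge0$. Then the optional projection $X^{\mathcal G}$ of $X$ with respect to $\mathcal G$ exists, i.e. there is a càdlàg process $X^{\mathcal G}$, unique up to evanescence, with $X^{\mathcal G}_t=\mathbb E[X_t\mid\mathcal G_t]$ almost surely for each $t\ge0$. Moreover, $X^{\mathcal G}_{t-}=\mathbb E[X_{t-}\mid \mathcal G^-_t]$ almost surely for each $t>0$. If in addition $X$ is bounded and has integrable variation on compacts, then $X^{\mathcal G}$ has paths of finite variation on compacts (almost surely).
   Context: Standing framework. Let $(\Omega,\mathcal A,P)$ be a complete probability space where $\Omega$ is a Polish space and $\mathcal A$ its Borel $\sigma$-algebra; let $\mathcal Z\subset\mathcal A$ denote the family of $P$-null sets. Let $E$ be a separable complete metric space with Borel $\sigma$-algebra $\mathcal E$. Let $T_i:\Omega\to[0,\infty]$ and $Z_i:\Omega\to E$, $i\in\mathbb N$, be random variables such that for every $i\in\mathbb N$: $Z_{2i-1}=Z_{2i}$, $T_{2i-1}\le T_{2i}$, and $T_{2i-1}<T_{2i}$ on $\{T_{2i}<\infty\}$ (the odd-indexed times are arrival times of pieces of information, $T_{2i}$ is the deletion time of the piece $Z_{2i-1}$; no other ordering among the $T_i$ is assumed). Assume $\mathbb E[\sum_{i=1}^\infty\mathbf 1_{\{T_i\le t\}}]<\infty$ for all $t\ge0$. Information: for $t\ge0$, $\mathcal G_t=\sigma\big(\{T_{2i-1}\le t<T_{2i}\}\cap\{Z_{2i}\in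 B\}:B\in\mathcal E,i\in\mathbb N\big)\vee\mathcal Z$; for $t>0$, $\mathcal G^-_t=\sigma\big(\{T_{2i-1}< t\le T_{2i}\}\cap\{Z_{2i}\in B\}:B\in\mathcal E,i\in\mathbb N\big)\vee\mathcal Z$. The family $(\mathcal G_t)_{t\ge0}$ need not be monotone in $t$. *)

(* Defs.v *)
From HB Require Import structures.
From mathcomp Require Import all_boot all_order all_algebra.
From mathcomp Require Import all_classical all_reals all_analysis measurable_realfun.
Set Implicit Arguments. Unset Strict Implicit. Unset Printing Implicit Defensive.
Import Order.TTheory GRing.Theory Num.Theory.
Import numFieldNormedType.Exports.
Local Open Scope classical_set_scope.
Local Open Scope ring_scope.

Section Defs.
Context {R : realType}.

Definition is_metric {S : Type} (dist : S -> S -> R) :=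
  [/\ (forall x y, 0 <= dist x y),
      (forall x y, dist x y = 0 <-> x = y),
      (forall x y, dist x y = dist y x) &
      (forall x y z, dist x z <= dist x y + dist y z)].

Definition metric_separable {S : Type} (dist : S -> S -> R) :=
  exists D : set S, countable D /\
    forall x (e : R), 0 < e -> exists y, D y /\ dist x y < e.

Definition metric_complete {S : Type} (dist : S -> S -> R) :=
  forall u : nat -> S,
    (forall e : R, 0 < e -> exists N, forall m n, (N <= m)%N -> (N <= n)%N ->
        dist (u m) (u n) < e) ->
    exists x, forall e : R, 0 < e -> exists N, forall n, (N <= n)%N ->
        dist (u n) x < e.

Definition polish_metric {S : Type} (dist : S -> S -> R) :=
  [/\ is_metric dist, metric_separable dist & metric_complete dist].

Definition metric_open {S : Type} (dist : S -> S -> R) (U : set S) :=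
  forall x, U x -> exists e : R, 0 < e /\ forall y, dist x y < e -> U y.

Definition metric_borel {S : Type} (dist : S -> S -> R) : set (set S) :=
  <<s metric_open dist >>.

Definition polish_borel_space {d} (S : measurableType d) :=
  exists dist : S -> S -> R, polish_metric dist /\
    forall A : set S, measurable A <-> metric_borel dist A.

Definition polish_completed_space {d} {S : measurableType d}
  (P : probability S R) :=
  exists dist : S -> S -> R, polish_metric dist /\
    forall A : set S, measurable A <->
      exists B N, [/\ metric_borel dist B, metric_borel dist N, P N = 0%E &
                      (A `\` B) `|` (B `\` A) `<=` N].

Definition is_cond_exp {d} {S : measurableType d} (P : probability S R)
  (G : set (set S)) (X Y : S -> R) :=
  [/\ (forall B : set R, measurable B -> G (Y @^-1` B)),
      P.-integrable setT (EFin \o Y) &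
      forall A, G A -> (\int[P]_(w in A) (Y w)%:E = \int[P]_(w in A) (X w)%:E)%E].

Definition null_sets {d} {S : measurableType d} (P : probability S R) :=
  [set N : set S | measurable N /\ P N = 0%E].

(* index shift: paper's T_{2i-1}, T_{2i}, Z_{2i} (i >= 1) are here
   T (2i), T (2i+1), Z (2i+1) (i >= 0) *)
Definition Ginfo {d dE} {S : measurableType d} {E : measurableType dE}
  (P : probability S R) (T : nat -> S -> \bar R) (Z : nat -> S -> E) (t : R)
  : set (set S) :=
  <<s [set A | exists i B, measurable B /\
         A = [set w | (T i.*2 w <= t%:E < T i.*2.+1 w)%E] `&`
             (Z i.*2.+1 @^-1` B)] `|` null_sets P >>.

Definition Ginfo_minus {d dE} {S : measurableType d} {E : measurableType dE}
  (P : probability S R) (T : nat -> S -> \bar R) (Z : nat -> S -> E) (t : R)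
  : set (set S) :=
  <<s [set A | exists i B, measurable B /\
         A = [set w | (T i.*2 w < t%:E <= T i.*2.+1 w)%E] `&`
             (Z i.*2.+1 @^-1` B)] `|` null_sets P >>.

Definition cadlag (f : R -> R) :=
  (forall t, 0 <= t -> f x @[x --> t^'+] --> f t) /\
  (forall t, 0 < t -> cvg (f x @[x --> t^'-])).

Definition left_lim (f : R -> R) (t : R) : R := lim (f x @[x --> t^'-]).

End Defs.

(* Main.v *)
Require Import Defs.
From HB Require Import structures.
From mathcomp Require Import all_boot all_order all_algebra.
From mathcomp Require Import all_classical all_reals all_analysis measurable_realfun.
From mathcomp Require Import ring lra.
Import Order.TTheory GRing.Theory Num.Theory.
Import numFieldNormedType.Exports.
Local Open Scope classical_set_scope.
Local Open Scope ring_scope.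

(* Let A_s(t) be the event that the pieces active at time t are exactly those with index
   in the finite set s. On A_s(t) the information G_t reduces to the sigma-algebra H_s
   generated by the marks of these pieces and the null sets, which does not depend on t.
   Hence on A_s(t) the projection is the quotient of E[X_t 1_{A_s(t)} | H_s] by
   E[1_{A_s(t)} | H_s], and similarly for left limits. Numerator and denominator have
   càdlàg versions, because conditioning on a fixed sigma-algebra preserves a bound on the
   number of oscillations of a given size. The denominator is almost surely bounded away
   from zero on every interval in which s remains the active set. The càdlàg and finite
   variation properties therefore pass to the quotient, and only finitely many changes of
   the active set occur on compacts. *)

Set Implicit Arguments. Unset Strict Implicit. Unset Printing Implicit Defensive.

(** * Truncated variation and regularization of paths *)

(** A càdlàg path may have infinite variation, so each increment is reduced by [e]. The reduced sum
    is bounded over all chains in a compact interval. Giving back [e] per step, with [e] small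
    compared with [delta], bounds the number of increments of size [delta] of the conditional
    expectation. The other obstacle is the division: a conditional probability that is positive at
    each time might still tend to zero along some times. For a family of events totally ordered by
    inclusion this happens only on a null set. Such families arise by fixing a rational [q] and
    requiring that the active set be [s] at all rational times between [q] and [r]: these events are
    nested in [r] on either side of [q]. Time is uncountable, but rational times, chains of
    rationals and finite index sets are countable. Almost sure statements are made along these, and
    right-continuity extends them. *)

Section TruncatedVariation.
Context {R : realType}.
Implicit Types (f g h : R -> R) (e x y t K : R) (s : seq R) (I D : set R).

(** Variation along the chain [x :: s] in which every increment is lowered by [e] and cut at zero;
    [e = 0] gives the ordinary variation along the chain. *)
Fixpoint tvar e f x s : R :=
  if s is y :: s' then Num.max 0 (`|f y - f x| - e) + tvar e f y s' else 0.

Lemma tvar_ge0 e f x s : 0 <= tvar e f x s.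
Proof. by elim: s x => //= y s IH x; rewrite addr_ge0// le_max lexx. Qed.

Lemma tvar0_cons f x y s : tvar 0 f x (y :: s) = `|f y - f x| + tvar 0 f y s.
Proof. by rewrite /= subr0 max_r. Qed.

Lemma tvar_cat e f x s1 s2 :
  tvar e f x (s1 ++ s2) = tvar e f x s1 + tvar e f (last x s1) s2.
Proof. by elim: s1 x => [|y s IH] x /=; rewrite ?add0r// IH addrA. Qed.

Lemma tvar0_le e f x s : 0 <= e -> tvar 0 f x s <= e *+ size s + tvar e f x s.
Proof.
move=> e0; elim: s x => [|y s IH] x; first by rewrite mulr0n addr0.
rewrite tvar0_cons /= mulrS.
have := IH y; have : `|f y - f x| <= e + Num.max 0 (`|f y - f x| - e).
  by rewrite -lerBlDl le_max lexx orbT.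
lra.
Qed.

Lemma tvar0_comb (P : R -> Prop) f g h (A B : R) x s :
  (forall a b, P a -> P b -> a <= b -> `|h b - h a| <= A * `|f b - f a| + B * `|g b - g a|) ->
  path <=%R x s -> (forall y, y \in x :: s -> P y) ->
  tvar 0 h x s <= A * tvar 0 f x s + B * tvar 0 g x s.
Proof.
move=> H; elim: s x => [|y s IH] x /=; first by rewrite !mulr0 addr0.
move=> /andP[xy ys] Pxs; rewrite !subr0 !max_r//.
have Px : P x by apply: Pxs; rewrite inE eqxx.
have Py : P y by apply: Pxs; rewrite !inE eqxx orbT.
have := H x y Px Py xy.
have : tvar 0 h y s <= A * tvar 0 f y s + B * tvar 0 g y s.
  by apply: IH => // z zs; apply: Pxs; rewrite inE zs orbT.
rewrite !mulrDr; lra.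
Qed.

Lemma tvar0_nondecreasing (P : R -> Prop) f x s :
  (forall a b, P a -> P b -> a <= b -> f a <= f b) ->
  path <=%R x s -> (forall y, y \in x :: s -> P y) ->
  tvar 0 f x s = f (last x s) - f x.
Proof.
move=> H; elim: s x => [|y s IH] x /=; first by rewrite subrr.
move=> /andP[xy ys] Pxs; rewrite subr0 max_r//.
have Px : P x by apply: Pxs; rewrite inE eqxx.
have Py : P y by apply: Pxs; rewrite !inE eqxx orbT.
rewrite IH//; last by move=> z zs; apply: Pxs; rewrite inE zs orbT.
by rewrite ger0_norm ?subr_ge0 ?H//; lra.
Qed.

(** [I] is an arbitrary set, so the notion serves intervals as well as their rational points. If [I]
    is empty, every [K] is a bound, negative ones included; hence the case distinctions on a point
    of [I] below. *)
Definition tvb e f I K := forall x s, path <=%R x s ->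
  (forall y, y \in x :: s -> I y) -> tvar e f x s <= K.

Lemma tvb_sub e f I J K : J `<=` I -> tvb e f I K -> tvb e f J K.
Proof. by move=> JI b x s px xs; apply: b => // y /xs /JI. Qed.

Lemma tvb_osc e f I K x y : tvb e f I K -> I x -> I y -> `|f y - f x| <= K + e.
Proof.
move=> b Ix Iy; wlog xy : x y Ix Iy / x <= y.
  by move=> H; have [|/ltW] := leP x y; [exact: H|rewrite distrC; exact: H].
have : tvar e f x [:: y] <= K.
  by apply: b; rewrite /= ?xy// => z; rewrite !inE => /orP[]/eqP->.
rewrite /= addr0 -lerBlDr; apply: le_trans; by rewrite le_max lexx orbT.
Qed.

(** A nondecreasing chain that has entered [J] cannot return to [I], so the cut is made at its first
    point in [J]. *)
Lemma path_split I J x s : (forall y z, I y -> J z -> y < z) ->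
  path <=%R x s -> (forall y, y \in x :: s -> (I `|` J) y) -> I x ->
  exists s1 s2, [/\ s = s1 ++ s2, forall y, y \in x :: s1 -> I y & forall y, y \in s2 -> J y].
Proof.
move=> IJ; elim: s x => [|y s IH] x /= px Pxs Ix.
  by exists [::], [::]; split => // y; rewrite inE => /eqP->.
move: px => /andP[xy ys].
have [Iy|Jy] : (I `|` J) y by apply: Pxs; rewrite !inE eqxx orbT.
  have [||s1 [s2 [-> h1 h2]]] := IH y _ _ Iy => //.
    by move=> z zs; apply: Pxs; rewrite inE zs orbT.
  exists (y :: s1), s2; split => // z; rewrite inE => /orP[/eqP->//|]; exact: h1.
exists [::], (y :: s); split => //; first by move=> z; rewrite inE => /eqP->.
move=> z zs; have yz : y <= z.
  move: zs; rewrite inE => /orP[/eqP->//|zs].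
  by move: ys; rewrite le_path_sortedE => /andP[/allP/(_ _ zs)].
have [Iz|//] : (I `|` J) z by apply: Pxs; rewrite inE zs orbT.
by have := IJ _ _ Iz Jy; rewrite ltNge yz.
Qed.

Lemma tvb_setU e f I J K L : 0 <= e -> (forall y z, I y -> J z -> y < z) ->
  tvb e f I K -> tvb e f J L -> exists M, tvb e f (I `|` J) M.
Proof.
move=> e0 IJ bI bJ.
have [[p Ip]|nI] := pselect (exists p, I p); last first.
  exists L; apply: tvb_sub bJ => y [Iy|//]; exfalso; apply: nI; by exists y.
have [[q Jq]|nJ] := pselect (exists q, J q); last first.
  exists K; apply: tvb_sub bI => y [//|Jy]; exfalso; apply: nJ; by exists y.
have K0 : 0 <= K by apply: (bI p [::]) => // y; rewrite inE => /eqP->.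
have L0 : 0 <= L by apply: (bJ q [::]) => // y; rewrite inE => /eqP->.
(* [K] and [L] bound the parts of the chain inside [I] and [J]. The single increment across is
   compared with [f q - f p]: by [tvb_osc] its endpoints deviate from [f p] and [f q] by at most
   [K + e] and [L + e]. *)
exists (K + (K + e + `|f q - f p| + (L + e) + L)) => x s px Pxs.
have nn := normr_ge0 (f q - f p).
have [Ix|Jx] : (I `|` J) x by apply: Pxs; rewrite inE eqxx.
  have [s1 [s2 [E h1 h2]]] := path_split IJ px Pxs Ix.
  rewrite E tvar_cat; move: px; rewrite E cat_path => /andP[p1 p2].
  apply: lerD; first exact: bI.
  case: s2 => [|y s2] /= in E h2 p2 *; first by lra.
  have Jy : J y by apply: h2; rewrite inE eqxx.
  have Il : I (last x s1) by apply: h1; rewrite mem_last.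
  have o1 := tvb_osc bI Il Ip; have o2 := tvb_osc bJ Jq Jy.
  move: p2 => /andP[_ p2]; have := bJ y s2 p2 h2.
  have : Num.max 0 (`|f y - f (last x s1)| - e) <= `|f y - f (last x s1)|.
    by rewrite ge_max normr_ge0/=; lra.
  have : `|f y - f (last x s1)| <= `|f y - f q| + `|f q - f p| + `|f p - f (last x s1)|.
    have -> : f y - f (last x s1) = (f y - f q) + (f q - f p) + (f p - f (last x s1)) by ring.
    by apply: (le_trans (ler_normD _ _)); rewrite lerD2r ler_normD.
  lra.
have := bJ x s px; suff: forall y, y \in x :: s -> J y by move=> h /(_ h); lra.
move=> z zs; have xz : x <= z.
  move: zs; rewrite inE => /orP[/eqP->//|zs].
  by move: px; rewrite le_path_sortedE => /andP[/allP/(_ _ zs)].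
have [Iz|//] : (I `|` J) z by exact: Pxs.
by have := IJ _ _ Iz Jx; rewrite ltNge xz.
Qed.

(** Compactness by a supremum argument. The supremum [c] of the times reached is itself reached, by
    gluing [[0, t]], []t, c[] and the point [c]; it equals [n], since otherwise a right
    neighbourhood of [c] could be glued on. *)
Lemma tvb_local_global e f : 0 <= e ->
  (forall t, 0 <= t -> exists eta, 0 < eta /\ exists K, tvb e f `[t, t + eta[ K) ->
  (forall t, 0 < t -> exists eta, 0 < eta /\ exists K, tvb e f `]t - eta, t[ K) ->
  forall n, 0 <= n -> exists K, tvb e f `[0, n] K.
Proof.
move=> e0 hr hl n n0.
pose A := [set t | 0 <= t <= n /\ exists K, tvb e f `[0, t] K].
have A0 : A 0.
  split; first by rewrite lexx.
  have [eta [eta0 [K b]]] := hr 0 (lexx _); exists K; apply: tvb_sub b => y /=.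
  by rewrite !in_itv/= => /andP[-> y0]; rewrite add0r (le_lt_trans y0).
have hsA : has_sup A by split; [exists 0|exists n => t [/andP[]]].
pose c := sup A.
have c0 : 0 <= c by apply: ub_le_sup => //; case: hsA.
have cn : c <= n by apply: ge_sup; [exists 0|move=> t [/andP[]]].
have [er [er0 [Kr br]]] := hr c c0.
have Ac : exists K, tvb e f `[0, c] K.
  have [->|cN0] := eqVneq c 0; first by case: A0.
  have cgt0 : 0 < c by rewrite lt_neqAle eq_sym cN0.
  have [el [el0 [Kl bl]]] := hl c cgt0.
  have [t [tn [K b]] tc] := sup_adherent el0 hsA.
  have tc' : t <= c by apply: ub_le_sup; [case: hsA|split => //; exists K].
  have [tE|tNc] := eqVneq t c; first by exists K; rewrite -tE.
  have ltc : t < c by rewrite lt_neqAle tNc.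
  have bl' : tvb e f `]t, c[ Kl.
    apply: tvb_sub bl => y /=; rewrite !in_itv/= => /andP[ty ->]; rewrite andbT.
    exact: lt_trans ty.
  have [] := tvb_setU e0 _ b bl'.
    by move=> y z /=; rewrite !in_itv/= => /andP[_ yt] /andP[tz _]; exact: le_lt_trans tz.
  move=> M bM.
  have bc : tvb e f [set c] Kr.
    by apply: tvb_sub br => y /= ->; rewrite in_itv/= lexx ltrDl.
  have [] := @tvb_setU e f (`[0, t] `|` `]t, c[) [set c] M Kr e0 _ bM bc.
    move=> y z /= yt ->; move: yt => [|]; rewrite !in_itv/= => /andP[_]//.
    by move=> /le_lt_trans; apply.
  move=> M' bM'; exists M'; apply: tvb_sub bM' => y /=; rewrite !in_itv/= => /andP[y0 yc].
  have [yt|ty] := leP y t; first by left; left; rewrite y0.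
  have [->|yNc] := eqVneq y c; first by right.
  by left; right; rewrite lt_neqAle yNc.
have [cnE|cNn] := eqVneq c n; first by rewrite -cnE.
have ltcn : c < n by rewrite lt_neqAle cNn.
have [K bK] := Ac.
have br' : tvb e f `]c, c + er[ Kr.
  by apply: tvb_sub br => y /=; rewrite !in_itv/= => /andP[/ltW-> ->].
have [] := tvb_setU e0 _ bK br'.
  by move=> y z /=; rewrite !in_itv/= => /andP[_ yt] /andP[tz _]; exact: le_lt_trans tz.
move=> M bM; exfalso.
pose t := Num.min n (c + er / 2).
have : t <= c.
  apply: ub_le_sup; first by case: hsA.
  split; first by rewrite le_min ge_min lexx n0/= andbT addr_ge0// divr_ge0// ltW.
  exists M; apply: tvb_sub bM => y /=; rewrite !in_itv/= le_min => /andP[y0 /andP[yn yc]].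
  have [yc'|yc'] := leP y c; [left|right]; first by rewrite y0.
  by apply/andP; split => //; lra.
by rewrite ge_min => /orP[]; lra.
Qed.

Lemma le_path_last x s y : path <=%R x s -> y \in x :: s -> y <= last x s.
Proof.
elim: s x => [|z s IH] x /=; first by move=> _; rewrite inE => /eqP->.
move=> /andP[xz zs]; rewrite inE => /orP[/eqP->|]; last exact: IH.
apply: (le_trans xz); move: zs; clear; elim: s z => //= a s IH z /andP[za /IH]; exact: le_trans.
Qed.

(** The partitions in [total_variation] are strictly increasing chains from [0] to [n], hence among
    the chains covered by [tvb]. *)
Lemma tvb_total_variation f n K : 0 <= n -> tvb 0 f `[0, n] K ->
  (total_variation 0 n f < +oo)%E.
Proof.
move=> n0 b; apply: (@le_lt_trans _ _ K%:E); last exact: ltry.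
apply: ub_ereal_sup => _ [_ [s [ps /eqP ls]] <-] <-; rewrite lee_fin.
have -> : variation 0 n f s = tvar 0 f 0 s.
  have E x : variation x n f s = tvar 0 f x s.
    rewrite /variation /=; elim: s x {ps ls} => [|y s IH] x; first by rewrite /= big_geq.
    by rewrite big_nat_recl//= subr0 max_r// IH.
  exact: E.
have ps' : path <=%R 0 s by apply: sub_path ps => u v; exact: ltW.
apply: b => // y ys; rewrite /= in_itv/= -ls le_path_last// andbT.
move: ys; rewrite inE => /orP[/eqP->//|ys].
by move: ps'; rewrite le_path_sortedE => /andP[/allP/(_ _ ys)].
Qed.

(** The chain may repeat points and need not join [0] to [n]; additivity of the total variation over
    adjacent intervals absorbs the missing ends. *)
Lemma tvar_total_variation f n x s : path <=%R x s -> 0 <= x ->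
  (forall y, y \in x :: s -> 0 <= y <= n) ->
  ((tvar 0 f x s)%:E <= total_variation 0 n f)%E.
Proof.
move=> px x0 xs.
suff: ((tvar 0 f x s)%:E <= total_variation x n f)%E.
  move=> /le_trans; apply; rewrite (@total_variationD _ 0 n x)//.
    by rewrite leeDr// total_variation_ge0.
  by have /andP[] := xs x (mem_head _ _).
elim: s x {x0} px xs => [|y s IH] x /=.
  by move=> _ /(_ x (mem_head _ _)) /andP[_ xn]; exact: total_variation_ge0.
move=> /andP[xy ys] Pxs; rewrite subr0 max_r// EFinD.
have /andP[_ yn] : 0 <= y <= n by apply: Pxs; rewrite !inE eqxx orbT.
rewrite (@total_variationD _ x n y)//; apply: leeD.
  exact: total_variation_ge.
by apply: IH => // z zs; apply: Pxs; rewrite inE zs orbT.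
Qed.

(** The increment of the quotient is [(f b - f a) / g b - f a * (g b - g a) / (g a * g b)]. The
    denominators are controlled by [eps], and [C] bounds [f] on [I] because [f] stays within [K] of
    the fixed value [f p]. *)
Lemma tvb_div f g I K L eps : 0 < eps -> (forall y, I y -> eps <= g y) ->
  tvb 0 f I K -> tvb 0 g I L -> exists M, tvb 0 (fun y => f y / g y) I M.
Proof.
move=> eps0 geps bf bg.
have [[p Ip]|nI] := pselect (exists p, I p); last first.
  exists 0 => x s _ /(_ x (mem_head _ _)) Ix; exfalso; apply: nI; by exists x.
pose C := `|f p| + `|K|.
have fC y : I y -> `|f y| <= C.
  move=> Iy; have := tvb_osc bf Ip Iy; rewrite addr0 => h.
  have : `|f y| <= `|f y - f p| + `|f p| by rewrite -{1}(subrK (f p) (f y)) ler_normD.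
  have := ler_norm K; rewrite /C; lra.
have C0 : 0 <= C by rewrite addr_ge0.
exists (eps^-1 * `|K| + (C / eps ^+ 2) * `|L|) => x s px xs.
apply: (le_trans (@tvar0_comb I f g _ eps^-1 (C / eps ^+ 2) x s _ px xs)).
  move=> a b Ia Ib _.
  have ga := geps a Ia; have gb := geps b Ib.
  have ga0 : 0 < g a := lt_le_trans eps0 ga.
  have gb0 : 0 < g b := lt_le_trans eps0 gb.
  have -> : f b / g b - f a / g a = (g b)^-1 * (f b - f a) + (- (f a / (g a * g b))) * (g b - g a).
    by field; rewrite !gt_eqF.
  apply: (le_trans (ler_normD _ _)); rewrite !normrM normrN; apply: lerD.
    by apply: ler_wpM2r => //; rewrite gtr0_norm ?invr_gt0// lef_pV2.
  apply: ler_wpM2r => //; rewrite normrM; apply: ler_pM => //; first exact: fC.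
  rewrite gtr0_norm ?invr_gt0 ?mulr_gt0// lef_pV2 ?posrE ?mulr_gt0// expr2.
  by apply: ler_pM => //; exact: ltW.
apply: lerD; apply: ler_wpM2l; rewrite ?invr_ge0 ?divr_ge0 ?exprn_ge0 ?(ltW eps0)//.
  by apply: (le_trans (bf _ _ px xs)); exact: ler_norm.
by apply: (le_trans (bg _ _ px xs)); exact: ler_norm.
Qed.

Lemma tvb_eq e f g I K : (forall y, I y -> f y = g y) -> tvb e f I K -> tvb e g I K.
Proof.
move=> fg b x s px xs; have := b x s px xs.
suff -> : tvar e f x s = tvar e g x s by [].
elim: s x {px} xs => //= y s IH x xs.
rewrite !fg ?IH//; first by move=> z zs; apply: xs; rewrite inE zs orbT.
- by apply: xs; rewrite inE eqxx.
- by apply: xs; rewrite !inE eqxx orbT.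
Qed.

(** One-sided limits along [D], the point [t] excluded. [D] will be the rationals, where a process
    given only up to null sets can be controlled, or [setT], which gives back the filter limits. *)
Definition rlim D f t (l : R) := forall e, 0 < e -> exists eta, 0 < eta /\
  forall x, D x -> t < x < t + eta -> `|f x - l| < e.
Definition llim D f t (l : R) := forall e, 0 < e -> exists eta, 0 < eta /\
  forall x, D x -> t - eta < x < t -> `|f x - l| < e.

Lemma rlimP f t l : rlim setT f t l <-> f x @[x --> t^'+] --> l.
Proof.
split=> [H|/cvgrPdist_lt H e e0].
  apply/cvgrPdist_lt => e e0; have [eta [eta0 h]] := H e e0.
  near=> x; rewrite distrC; apply: h => //; apply/andP; split => //.
  by near: x; apply: nbhs_right_lt; rewrite ltrDl.
have [eta /= eta0 h] := H e e0; exists eta; split => // x _ /andP[tx xt].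
rewrite distrC; apply: h => //=; rewrite distrC gtr0_norm ?subr_gt0//; lra.
Unshelve. all: by end_near. Qed.

Lemma llimP f t l : llim setT f t l <-> f x @[x --> t^'-] --> l.
Proof.
split=> [H|/cvgrPdist_lt H e e0].
  apply/cvgrPdist_lt => e e0; have [eta [eta0 h]] := H e e0.
  near=> x; rewrite distrC; apply: h => //; apply/andP; split => //.
  by near: x; apply: nbhs_left_gt; rewrite ltrBlDr ltrDl.
have [eta /= eta0 h] := H e e0; exists eta; split => // x _ /andP[tx xt].
rewrite distrC; apply: h => //=; rewrite gtr0_norm ?subr_gt0//; lra.
Unshelve. all: by end_near. Qed.

Lemma left_limE f t l : llim setT f t l -> left_lim f t = l.
Proof. by move=> /llimP h; apply: cvg_lim. Qed.

Lemma cadlagP f : cadlag f <-> (forall t, 0 <= t -> rlim setT f t (f t)) /\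
  (forall t, 0 < t -> llim setT f t (left_lim f t)).
Proof.
split=> -[h1 h2]; split => t t0.
- exact/rlimP/h1.
- exact/llimP/h2.
- exact/rlimP/h1.
- by apply/cvg_ex; exists (left_lim f t); exact/llimP/h2.
Qed.

(** On a one-sided neighbourhood where [f] is within [e / 2] of its limit every increment is at most
    [e], so the truncated variation vanishes there. Compactness does the rest. *)
Lemma cadlag_tvb e f : 0 < e -> cadlag f -> forall n, 0 <= n -> exists K, tvb e f `[0, n] K.
Proof.
move=> e0 /cadlagP[hr hl]; have e20 : 0 < e / 2 by rewrite divr_gt0.
have small I l : (forall y, I y -> `|f y - l| < e / 2) -> tvb e f I 0.
  move=> H x s _ ; elim: s x => //= y s IH x xs.
  have Hx : `|f x - l| < e / 2 by apply/H/xs; rewrite inE eqxx.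
  have Hy : `|f y - l| < e / 2 by apply/H/xs; rewrite !inE eqxx orbT.
  have := IH y; rewrite max_l ?add0r.
    by apply => z zs; apply: xs; rewrite inE zs orbT.
  rewrite subr_le0 (_ : f y - f x = (f y - l) - (f x - l)); last by ring.
  apply: (le_trans (ler_normB _ _)); lra.
apply: tvb_local_global; first exact: ltW.
- move=> t t0; have [eta [eta0 h]] := hr t t0 _ e20; exists eta; split => //.
  exists 0; apply: (small _ (f t)) => y /=; rewrite in_itv/= => /andP[ty yt].
  have [->|yNt] := eqVneq y t; first by rewrite subrr normr0.
  by apply: h => //; rewrite lt_neqAle eq_sym yNt ty.
- move=> t t0; have [eta [eta0 h]] := hl t t0 _ e20; exists eta; split => //.
  by exists 0; apply: (small _ (left_lim f t)) => y /=; rewrite in_itv/=; exact: h.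
Qed.


Definition dense_set D := forall a b, a < b -> exists x, D x /\ a < x < b.

Lemma rlim_unique D f t l l' : dense_set D -> rlim D f t l -> rlim D f t l' -> l = l'.
Proof.
move=> dD h h'; apply/eqP; rewrite -subr_eq0 -normr_le0 leNgt; apply/negP => n0.
have e0 : 0 < `|l - l'| / 2 by rewrite divr_gt0.
have [eta [eta0 H]] := h _ e0; have [eta' [eta'0 H']] := h' _ e0.
have [x [Dx /andP[tx xt]]] := dD t (t + Num.min eta eta') ltac:(by rewrite ltrDl lt_min eta0).
have := H x Dx; have := H' x Dx; move: xt; rewrite -ltrBlDl lt_min => /andP[x1 x2].
rewrite tx/= -!ltrBlDl x1 x2 => /(_ isT) a /(_ isT) b.
have : `|l - l'| <= `|f x - l'| + `|f x - l|.
  have -> : l - l' = (f x - l') - (f x - l) by ring.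
  exact: ler_normB.
lra.
Qed.

Lemma regularization D f : dense_set D ->
  (forall t, 0 <= t -> exists l, rlim D f t l) ->
  (forall t, 0 < t -> exists l, llim D f t l) ->
  exists g, [/\ cadlag g, (forall t, 0 <= t -> rlim D f t (g t)) &
    (forall t, 0 < t -> llim D f t (left_lim g t))].
Proof.
move=> dD hr hl.
pose g t := xget 0 [set l | rlim D f t l].
have gr t : 0 <= t -> rlim D f t (g t).
  by move=> t0; rewrite /g; case: xgetP => // H; have [l] := hr t t0 => /H.
(* A strict bound along [D] on an open interval passes to [g] there as a weak bound.
   Right-continuity and left limits of [g] both follow from this transfer. *)
have key t u v l e : 0 <= t -> u < t < v -> (forall x, D x -> u < x < v -> `|f x - l| < e) ->
    `|g t - l| <= e.
  move=> t0 /andP[ut tv] H; rewrite leNgt; apply/negP => n0.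
  have e0 : 0 < `|g t - l| - e by rewrite subr_gt0.
  have [eta [eta0 h]] := gr t t0 _ e0.
  have [x [Dx /andP[tx xt]]] := dD t (Num.min v (t + eta)) ltac:(by rewrite lt_min tv ltrDl).
  move: xt; rewrite lt_min => /andP[xv xe].
  have a := h x Dx ltac:(by rewrite tx). have b := H x Dx ltac:(by rewrite xv (lt_trans ut)).
  have : `|g t - l| <= `|f x - l| + `|f x - g t|.
    have -> : g t - l = (f x - l) - (f x - g t) by ring.
    exact: ler_normB.
  lra.
have gl t l : 0 < t -> llim D f t l -> llim setT g t l.
  move=> t0 h e e0; have e20 : 0 < e / 2 by rewrite divr_gt0.
  have [eta [eta0 H]] := h _ e20.
  (* Cutting [eta] at [t] keeps the points positive; [g] is known to be a right limit only at
     nonnegative times. *)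
  exists (Num.min eta t); split; first by rewrite lt_min eta0.
  move=> x _ /andP[tx xt].
  have {tx} [tx x0] : t - eta < x /\ 0 < x.
    by move: tx; rewrite ltrBlDr -ltrBlDl lt_min => /andP[]; split; lra.
  apply: (@le_lt_trans _ _ (e / 2)); last by lra.
  by apply: (key x (t - eta) t) => //; [exact: ltW|rewrite tx xt].
exists g; split => //.
- apply/cadlagP; split => t t0.
    move=> e e0; have e20 : 0 < e / 2 by rewrite divr_gt0.
    have [eta [eta0 H]] := gr t t0 _ e20; exists eta; split => // x _ /andP[tx xt].
    apply: (@le_lt_trans _ _ (e / 2)); last by lra.
    by apply: (key x t (t + eta)) => //; [lra|rewrite tx xt].
  have [l hl'] := hl t t0; have := gl t l t0 hl'.
  by move=> h; rewrite (left_limE h).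
- move=> t t0; have [l hl'] := hl t t0; have := gl t l t0 hl'.
  by move=> h; rewrite (left_limE h).
Qed.

Definition jumps (delta : R) f := fun a b => (a <= b) && (delta < `|f b - f a|).

Lemma tvar0_jumps delta f x s : path (jumps delta f) x s ->
  delta *+ size s <= tvar 0 f x s.
Proof.
elim: s x => [|y s IH] x; first by rewrite mulr0n.
rewrite tvar0_cons /= => /andP[/andP[_ /ltW d] /IH h]; rewrite mulrS; lra.
Qed.

Lemma path_jumps_le delta f x s : path (jumps delta f) x s -> path <=%R x s.
Proof. by apply: sub_path => a b /andP[]. Qed.

Lemma limit_along (B : nat -> set R) f : (forall n, exists x, B n x) ->
  (forall m n, (m <= n)%N -> B n `<=` B m) ->
  (forall e, 0 < e -> exists n, forall x y, B n x -> B n y -> `|f x - f y| <= e) ->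
  exists l, forall e, 0 < e -> exists n, forall x, B n x -> `|f x - l| < e.
Proof.
move=> B0 Bd H; have [u hu] := choice B0.
have /cauchy_cvgP/cvg_ex[l hl] : cauchy (f \o u @ \oo).
  apply: cauchy_exP => e e0; have e20 : 0 < e / 2 by rewrite divr_gt0.
  have [n h] := H _ e20; exists (f (u n)); exists n => // m /= nm.
  rewrite /ball /= (le_lt_trans (h _ _ (hu n) (Bd _ _ nm _ (hu m))))//; lra.
exists l => e e0; have e20 : 0 < e / 2 by rewrite divr_gt0.
have [n h] := H _ e20; exists n => x Bx.
move/cvgrPdist_lt : hl => /(_ _ e20) [N _ hN].
have /= h1 := hN (maxn n N) (leq_maxr _ _).
have h2 := h x _ Bx (Bd _ _ (leq_maxl n N) _ (hu (maxn n N))).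
have : `|f x - l| <= `|f x - f (u (maxn n N))| + `|l - f (u (maxn n N))|.
  have -> : f x - l = (f x - f (u (maxn n N))) - (l - f (u (maxn n N))) by ring.
  exact: ler_normB.
lra.
Qed.

Lemma exists_invS_lt (eta : R) : 0 < eta -> exists n, n.+1%:R^-1 < eta.
Proof. by move=> /ltr_add_invr[n]; rewrite add0r; exists n. Qed.

Lemma ler_invS (m n : nat) : (m <= n)%N -> n.+1%:R^-1 <= m.+1%:R^-1 :> R.
Proof. by move=> mn; rewrite lef_pV2 ?posrE// ler_nat. Qed.

(** Without a right limit, points arbitrarily close to [t] have values more than some [e] apart, and
    one of two such values differs from [f x] by more than [e / 2]. A chain starting at [x] can then
    be prolonged towards [t] again and again, against the bound on its length. *)
Lemma bounded_jumps_rlim D f t : dense_set D ->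
  (forall delta, 0 < delta -> exists m, forall x s, path (jumps delta f) x s ->
    (forall y, y \in x :: s -> D y /\ t < y < t + 1) -> (size s <= m)%N) ->
  exists l, rlim D f t l.
Proof.
move=> dD H; pose B n := [set x | D x /\ t < x < t + n.+1%:R^-1].
have B0 n : exists x, B n x by apply: dD; rewrite ltrDl.
have [||l hl] := @limit_along B f B0.
- move=> m n mn x [Dx /andP[tx xt]]; split => //; rewrite tx (lt_le_trans xt)//.
  by rewrite lerD2l ler_invS.
- move=> e e0; apply: contrapT => /forallNP C.
  have {}C n : exists a b, [/\ B n a, B n b & e < `|f a - f b|].
    apply: contrapT => nC; apply: (C n) => x y Bx By; rewrite leNgt; apply/negP => h.
    by apply: nC; exists x, y.
  have e20 : 0 < e / 2 by rewrite divr_gt0.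
  have [m hm] := H _ e20.
  suff S k : exists x s, [/\ path (jumps (e / 2) f) x s,
      (forall y, y \in x :: s -> D y /\ t < y < t + 1) & size s = k].
    have [x [s [ps xs ss]]] := S m.+1.
    by have := hm x s ps xs; rewrite ss ltnn.
  elim: k => [|k [x [s [ps xs ss]]]].
    have [x [Dx xt]] := B0 0%N; exists x, [::]; split => // y; rewrite inE => /eqP->.
    by move: xt; rewrite invr1.
  have [Dx /andP[tx xt]] := xs x (mem_head _ _).
  have /exists_invS_lt[n hn] : 0 < x - t by rewrite subr_gt0.
  have [a [b [Ba Bb ab]]] := C n.
  have [z [Bz zx]] : exists z, B n z /\ e / 2 < `|f x - f z|.
    have [h|h] := ltP (e / 2) `|f x - f a|; first by exists a.
    exists b; split => //.
    have : `|f a - f b| <= `|f x - f b| + `|f x - f a|.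
      have -> : f a - f b = (f x - f b) - (f x - f a) by ring.
      exact: ler_normB.
    lra.
  have [Dz /andP[tz zt]] := Bz.
  have zx' : z < x by rewrite (lt_trans zt)// -ltrBrDl.
  exists z, (x :: s); split => //=; last by rewrite ss.
    by rewrite /jumps (ltW zx') zx.
  move=> y; rewrite inE => /orP[/eqP->|]; last exact: xs.
  by split => //; rewrite tz/=; lra.
exists l => e /hl[n h]; exists n.+1%:R^-1; split; first by rewrite invr_gt0.
by move=> x Dx tx; apply: h.
Qed.

(** Mirror image of the right limit: here the chain is prolonged at its last point. Only positive
    points occur, since the processes are controlled on nonnegative times only. *)
Lemma bounded_jumps_llim D f t : dense_set D -> 0 < t ->
  (forall delta, 0 < delta -> exists m, forall x s, path (jumps delta f) x s ->
    (forall y, y \in x :: s -> D y /\ 0 < y < t) -> (size s <= m)%N) ->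
  exists l, llim D f t l.
Proof.
move=> dD t0 H; pose B n := [set x | D x /\ (0 < x /\ t - n.+1%:R^-1 < x < t)].
have B0 n : exists x, B n x.
  have mt : Num.max 0 (t - n.+1%:R^-1) < t by rewrite gt_max t0/= ltrBlDr ltrDl.
  have [x [Dx /andP[]]] := dD _ _ mt.
  by rewrite gt_max => /andP[x0 tx] xt; exists x; rewrite /B /= x0 tx xt.
have [||l hl] := @limit_along B f B0.
- move=> m n mn x [Dx [x0 /andP[tx xt]]]; split => //; split => //; rewrite xt andbT (le_lt_trans _ tx)//.
  by rewrite lerD2l lerN2 ler_invS.
- move=> e e0; apply: contrapT => /forallNP C.
  have {}C n : exists a b, [/\ B n a, B n b & e < `|f a - f b|].
    apply: contrapT => nC; apply: (C n) => x y Bx By; rewrite leNgt; apply/negP => h.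
    by apply: nC; exists x, y.
  have e20 : 0 < e / 2 by rewrite divr_gt0.
  have [m hm] := H _ e20.
  suff S k : exists x s, [/\ path (jumps (e / 2) f) x s,
      (forall y, y \in x :: s -> D y /\ 0 < y < t) & size s = k].
    have [x [s [ps xs ss]]] := S m.+1.
    by have := hm x s ps xs; rewrite ss ltnn.
  elim: k => [|k [x [s [ps xs ss]]]].
    have [x [Dx [x0 /andP[_ xt]]]] := B0 0%N; exists x, [::]; split => // y; rewrite inE => /eqP->.
    by rewrite x0 xt.
  have [Dx /andP[tx xt]] := xs _ (mem_last x s).
  set v := last x s in Dx tx xt.
  have /exists_invS_lt[n hn] : 0 < t - v by rewrite subr_gt0.
  have [a [b [Ba Bb ab]]] := C n.
  have [z [Bz zx]] : exists z, B n z /\ e / 2 < `|f z - f v|.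
    have [h|h] := ltP (e / 2) `|f a - f v|; first by exists a.
    exists b; split => //.
    have : `|f a - f b| <= `|f a - f v| + `|f b - f v|.
      have -> : f a - f b = (f a - f v) - (f b - f v) by ring.
      exact: ler_normB.
    lra.
  have [Dz [z0 /andP[tz zt]]] := Bz.
  have zx' : v < z by rewrite (lt_trans _ tz)// ltrBrDr -ltrBrDl.
  exists x, (rcons s z); split => //=; last by rewrite size_rcons ss.
    by rewrite rcons_path ps /jumps (ltW zx') zx.
  move=> y; rewrite -rcons_cons mem_rcons inE => /orP[/eqP->|]; last exact: xs.
  by rewrite z0 zt.
exists l => e /hl[n h]; exists (Num.min n.+1%:R^-1 t); split.
  by rewrite lt_min invr_gt0 ltr0Sn.
move=> x Dx /andP[]; rewrite ltrBlDr -ltrBlDl lt_min => /andP[t1 t2] xt; apply: h.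
by split => //; split; [lra|rewrite xt andbT ltrBlDr -ltrBlDl].
Qed.

(* By right-continuity a chain can be moved to nearby points of [D]. *)
Lemma tvb_dense D f (n K : R) : dense_set D -> (forall t, 0 <= t -> rlim setT f t (f t)) ->
  tvb 0 f (D `&` `[0, n + 1]) K -> tvb 0 f `[0, n] K.
Proof.
move=> dD rc b x s px xs.
suff H : forall e, 0 < e -> exists y s', [/\ x < y, path <=%R y s',
    (forall z, z \in y :: s' -> (D `&` `[0, n + 1]) z), `|f y - f x| <= e &
    tvar 0 f x s <= tvar 0 f y s' + e].
  apply/ler_addgt0Pr => e e0; have [y [s' [_ py ys _ h]]] := H e e0.
  by have := b y s' py ys; lra.
elim: s x px xs => [|x' s IH] x px xs e e0.
  have := xs x (mem_head _ _); rewrite /= in_itv/= => /andP[x0 xn].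
  have [eta [eta0 h]] := rc x x0 _ e0.
  (* The shift to the right may leave [[0, n]], but by less than [1]; this is why the bound is
     assumed on [[0, n + 1]]. *)
  have [y [Dy /andP[xy yx]]] := dD x (x + Num.min eta 1) ltac:(by rewrite ltrDl lt_min eta0 ltr01).
  have {yx} [y1 y2] : y < x + eta /\ y < x + 1.
    by move: yx; rewrite -ltrBlDl lt_min => /andP[]; split; lra.
  exists y, [::]; split => //=; last by lra.
    by move=> z; rewrite inE => /eqP->; split => //=; rewrite in_itv/=; lra.
  by apply/ltW/h => //; rewrite xy.
move: px => /= /andP[xx' px'].
have e20 : 0 < e / 4 by rewrite divr_gt0.
have [|y' [s' [xy' py' ys' fy h]]] := IH x' px' _ (e / 4) e20.
  by move=> z zs; apply: xs; rewrite inE zs orbT.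
have := xs x (mem_head _ _); rewrite /= in_itv/= => /andP[x0 xn].
have [eta [eta0 h']] := rc x x0 _ e20.
(* The chain is moved from its end backwards. The strict inequality [x' < y'] from the induction
   leaves room for [y] between [x] and [y'], so the order is kept. *)
have [y [Dy /andP[xy yx]]] := dD x (Num.min (x + eta) y')
    ltac:(by rewrite lt_min ltrDl eta0 (le_lt_trans xx')).
move: yx; rewrite lt_min => /andP[yx yy'].
have fyx : `|f y - f x| < e / 4 by apply: h' => //; rewrite xy.
exists y, (y' :: s'); split => //.
- by rewrite /= (ltW yy').
- move=> z; rewrite inE => /orP[/eqP->|]; last exact: ys'.
  split => //=; rewrite in_itv/=; have [_ /=] := ys' y' (mem_head _ _).
  by rewrite in_itv/= => /andP[_ yn]; lra.
- by lra.
rewrite tvar0_cons subr0 max_r//.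
have : `|f x' - f x| <= `|f y' - f y| + `|f y - f x| + `|f y' - f x'|.
  have -> : f x' - f x = (f y' - f y) + (f y - f x) - (f y' - f x') by ring.
  by apply: (le_trans (ler_normB _ _)); rewrite lerD2r ler_normD.
lra.
Qed.

End TruncatedVariation.

(** * Conditional expectation *)

Section CondExp.
Context {R : realType} d (O : measurableType d) (P : probability O R).
Variable G : set (set O).
Hypothesis GM : G `<=` measurable.
Local Notation CE := (is_cond_exp P <<s G >>).
Local Notation Int f := (P.-integrable setT (EFin \o f)).

Lemma sigma_gen_measurable A : <<s G >> A -> measurable A.
Proof. exact: (smallest_sub (sigma_algebra_measurable _) GM). Qed.

(** The measurability clause of [is_cond_exp]. Its reading as measurability on
    [g_sigma_algebraType G] gives access to the closure properties of measurable functions. *)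
Definition sub_measurable (Y : O -> R) :=
  forall B : set R, measurable B -> <<s G >> (Y @^-1` B).

Lemma sub_measurableE (Y : O -> R) :
  sub_measurable Y <-> measurable_fun setT (Y : g_sigma_algebraType G -> R).
Proof.
split=> [mY _ B mB|mY B mB]; first by rewrite setTI; exact: mY.
by have := mY measurableT B mB; rewrite setTI.
Qed.

Lemma measurable_gen_id : measurable_fun setT (id : O -> g_sigma_algebraType G).
Proof. by move=> _ B mB; rewrite setTI; exact: sigma_gen_measurable. Qed.

Lemma sub_measurable_fun (Y : O -> R) : sub_measurable Y -> measurable_fun setT Y.
Proof. by move=> mY _ B mB; rewrite setTI; apply: sigma_gen_measurable; exact: mY. Qed.

Lemma integrable_EFin_fun (f : O -> R) : Int f -> measurable_fun setT f.
Proof. by move=> /measurable_int /measurable_EFinP. Qed.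

Lemma integrable_sub_set (f : O -> R) A : measurable A -> Int f ->
  P.-integrable A (EFin \o f).
Proof. by move=> mA; apply: integrableS => //. Qed.

(** The event [f > g] is itself an admissible test set; the positive function [f - g] has integral
    at most zero over it, so the event is null. *)
Lemma sub_measurable_ae_le (f g : O -> R) : sub_measurable f -> sub_measurable g ->
  Int f -> Int g ->
  (forall A, <<s G >> A -> (\int[P]_(w in A) (f w)%:E <= \int[P]_(w in A) (g w)%:E)%E) ->
  {ae P, forall w, f w <= g w}.
Proof.
move=> mf mg fi gi fg.
pose h w := f w - g w; pose A := h @^-1` `]0, +oo[%classic.
have mh : sub_measurable h.
  by apply/sub_measurableE; apply: measurable_funB; exact/sub_measurableE.
have GA : <<s G >> A by exact: mh.
have mA := sigma_gen_measurable GA.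
have hE : (\int[P]_(w in A) `|(h w)%:E| = 0)%E.
  apply/eqP; rewrite eq_le integral_ge0 ?andbT//.
  have -> : (\int[P]_(w in A) `|(h w)%:E| = \int[P]_(w in A) (h w)%:E)%E.
    apply: eq_integral => w /set_mem; rewrite /A /= in_itv/= andbT => h0.
    by rewrite gtr0_norm.
  rewrite [X in (X <= _)%E](_ : _ = \int[P]_(w in A) ((f w)%:E - (g w)%:E)%E)%E//.
  rewrite integralB//; [|exact: integrable_sub_set fi|exact: integrable_sub_set gi].
  rewrite leeBlDr ?add0e ?fg//.
  by apply: integrable_fin_num => //; exact: integrable_sub_set gi.
have /(ae_eq_integral_abs P mA) : measurable_fun A (EFin \o h).
  by apply/measurable_EFinP; apply: measurable_funTS; exact: sub_measurable_fun.
case=> /(_ hE) + _; apply: filterS => w /= h0.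
rewrite leNgt; apply/negP => gf.
have Aw : A w by rewrite /A /= in_itv/= andbT subr_gt0.
by have [] := h0 Aw; move: Aw; rewrite /A /= in_itv/= andbT => + H; rewrite H ltxx.
Qed.

Lemma sub_measurable_ae_eq (f g : O -> R) : sub_measurable f -> sub_measurable g ->
  Int f -> Int g ->
  (forall A, <<s G >> A -> (\int[P]_(w in A) (f w)%:E = \int[P]_(w in A) (g w)%:E)%E) ->
  {ae P, forall w, f w = g w}.
Proof.
move=> mf mg fi gi fg.
have h1 : {ae P, forall w, f w <= g w}.
  by apply: sub_measurable_ae_le => // A GA; rewrite fg.
have h2 : {ae P, forall w, g w <= f w}.
  by apply: sub_measurable_ae_le => // A GA; rewrite fg.
apply: filterS2 h1 h2 => w H1 H2; apply/eqP; by rewrite eq_le H1 H2.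
Qed.

Lemma cond_exp_unique X Y Y' : CE X Y -> CE X Y' -> {ae P, forall w, Y w = Y' w}.
Proof.
move=> [mY iY eY] [mY' iY' eY']; apply: sub_measurable_ae_eq => // A GA.
by rewrite eY// eY'.
Qed.

(** The charge with density [X], pushed forward along the identity to [<<s G>>], is absolutely
    continuous with respect to the image of [P]. Its Radon-Nikodym derivative is the conditional
    expectation. *)
Lemma cond_exp_exists X : Int X -> exists Y, CE X Y.
Proof.
move=> iX.
pose nu := measure_function_pushforward__canonical__charge_Charge (induced_charge iX) measurable_gen_id.
pose idm : {mfun O >-> g_sigma_algebraType G} :=
  HB.pack (id : O -> g_sigma_algebraType G) (isMeasurableFun.Build _ _ _ _ _ measurable_gen_id).
pose mu : probability (g_sigma_algebraType G) R := distribution P idm.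
have numu : nu `<< mu.
  apply/null_content_dominatesP => A mA muA.
  apply: null_set_integral => //; first exact: sigma_gen_measurable.
  by apply: measurable_funTS; exact: (measurable_int _ iX).
pose f := Radon_Nikodym nu mu.
have fi : mu.-integrable setT f by exact: Radon_Nikodym_integrable.
have ffin w : f w \is a fin_num by exact: Radon_Nikodym_fin_num.
have mf := measurable_int _ fi.
have mfO : measurable_fun setT (f : O -> \bar R) := measurableT_comp mf measurable_gen_id.
have iO : P.-integrable setT (f : O -> \bar R).
  apply/integrableP; split => //; move/integrableP : (fi) => [_].
  rewrite ge0_integral_pushforward//; last exact: measurableT_comp.
have iE A : <<s G >> A -> (\int[mu]_(w in A) f w = \int[P]_(w in A) f w)%E.
  move=> GA; rewrite integral_pushforward//.
  by apply: integrableS iO => //; exact: sigma_gen_measurable.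
have eE : EFin \o (fine \o f) = f by apply/funext => w /=; rewrite fineK.
exists (fine \o f); split.
- by apply/sub_measurableE; exact: measurableT_comp mf.
- by rewrite eE.
- move=> A GA; rewrite [LHS](_ : _ = \int[P]_(w in A) f w)%E.
    by rewrite -iE// -Radon_Nikodym_integral.
  by apply: eq_integral => w _; rewrite /= fineK.
Qed.

Lemma integral_le_ae (f g : O -> R) A : measurable A -> Int f -> Int g ->
  {ae P, forall w, f w <= g w} ->
  (\int[P]_(w in A) (f w)%:E <= \int[P]_(w in A) (g w)%:E)%E.
Proof.
move=> mA fi gi fg.
(* [h] equals [g] almost surely and dominates [f] everywhere, so pointwise monotonicity of the
   integral applies. *)
pose h w := Num.max (f w) (g w).
have mf := integrable_EFin_fun fi; have mg := integrable_EFin_fun gi.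
have mh : measurable_fun setT h by exact: measurable_maxr.
have -> : (\int[P]_(w in A) (g w)%:E = \int[P]_(w in A) (h w)%:E)%E.
  apply: ae_eq_integral => //.
  - by apply/measurable_EFinP; exact: measurable_funTS.
  - by apply/measurable_EFinP; exact: measurable_funTS.
  - by apply: filterS fg => w fgw _; rewrite /h max_r.
apply: le_integral => //.
- exact: integrable_sub_set.
- apply: integrable_sub_set => //.
  apply: (@le_integrable _ _ _ _ _ _ _ (fun w => (`|f w| + `|g w|)%:E)) => //.
  + exact/measurable_EFinP.
  + move=> w _; rewrite /= lee_fin [leRHS]ger0_norm ?addr_ge0// /h.
    by case: (leP (f w) (g w)) => _; rewrite ?lerDl ?lerDr.
  + exact: (integrableD _ (integrable_abse fi) (integrable_abse gi)).
- by move=> w _; rewrite lee_fin /h le_max lexx.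
Qed.

Lemma cond_exp_le X X' Y Y' : Int X -> Int X' -> CE X Y -> CE X' Y' ->
  {ae P, forall w, X w <= X' w} -> {ae P, forall w, Y w <= Y' w}.
Proof.
move=> iX iX' [mY iY eY] [mY' iY' eY'] XX'; apply: sub_measurable_ae_le => // A GA.
by rewrite eY// eY'//; apply: integral_le_ae => //; exact: sigma_gen_measurable.
Qed.

Lemma cond_expD X X' Y Y' : Int X -> Int X' -> CE X Y -> CE X' Y' ->
  CE (fun w => X w + X' w) (fun w => Y w + Y' w).
Proof.
move=> iX iX' [mY iY eY] [mY' iY' eY']; split.
- by apply/sub_measurableE; apply: measurable_funD; exact/sub_measurableE.
- exact: (integrableD _ iY iY').
- move=> A GA; have mA := sigma_gen_measurable GA.
  rewrite (integralD mA (integrable_sub_set mA iY) (integrable_sub_set mA iY')).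
  rewrite (integralD mA (integrable_sub_set mA iX) (integrable_sub_set mA iX')).
  by rewrite /= eY// eY'.
Qed.

Lemma cond_expZ c X Y : Int X -> CE X Y ->
  CE (fun w => c * X w) (fun w => c * Y w).
Proof.
move=> iX [mY iY eY]; split.
- by apply/sub_measurableE; apply: measurable_funM => //; exact/sub_measurableE.
- exact: (integrableZl _ c iY).
- move=> A GA; have mA := sigma_gen_measurable GA.
  rewrite (integralZl mA (integrable_sub_set mA iY)).
  by rewrite (integralZl mA (integrable_sub_set mA iX)) /= eY.
Qed.

Lemma cond_exp_cst c : CE (fun=> c) (fun=> c).
Proof.
split => //; last exact: finite_measure_integrable_cst.
by apply/sub_measurableE; exact: measurable_cst.
Qed.

Lemma cond_expB X X' Y Y' : Int X -> Int X' -> CE X Y -> CE X' Y' ->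
  CE (fun w => X w - X' w) (fun w => Y w - Y' w).
Proof.
move=> iX iX' cX cX'.
have iN : Int (fun w => -1 * X' w) by exact: (integrableZl _ (-1) iX').
have := cond_expD iX iN cX (cond_expZ (-1) iX' cX').
by congr (is_cond_exp _ _ _ _); apply/funext => w; rewrite mulN1r.
Qed.

Lemma cond_exp_norm_le X X' Y Y' : Int X -> Int X' -> CE X Y -> CE X' Y' ->
  {ae P, forall w, `|X w| <= X' w} -> {ae P, forall w, `|Y w| <= Y' w}.
Proof.
move=> iX iX' cX cX' XX'.
have iN : Int (fun w => -1 * X w) by exact: (integrableZl _ (-1) iX).
have h1 : {ae P, forall w, Y w <= Y' w}.
  by apply: (cond_exp_le iX iX' cX cX'); apply: filterS XX' => w; rewrite ler_norml => /andP[].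
have h2 : {ae P, forall w, -1 * Y w <= Y' w}.
  apply: (cond_exp_le iN iX' (cond_expZ (-1) iX cX) cX').
  by apply: filterS XX' => w; rewrite ler_norml mulN1r lerNl => /andP[].
by apply: filterS2 h1 h2 => w H1 H2; rewrite ler_norml H1 lerNl -mulN1r H2.
Qed.

Hypothesis Pc : measure_is_complete P.
Hypothesis Gnull : null_sets P `<=` <<s G >>.

Lemma negligible_gen N : P.-negligible N -> <<s G >> N.
Proof.
move=> NN; apply: Gnull; have mN : measurable N by exact: Pc.
by split => //; exact/negligibleP.
Qed.

(** The two preimages differ only inside the exceptional set, all of whose subsets lie in the
    sigma-algebra by completeness and [Gnull]. *)
Lemma sub_measurable_ae (Y Y' : O -> R) : sub_measurable Y ->
  {ae P, forall w, Y w = Y' w} -> sub_measurable Y'.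
Proof.
move=> mY YY' B mB.
pose N := [set w | Y w <> Y' w].
have GN A : A `<=` N -> <<s G >> A.
  move=> AN; apply: negligible_gen; exact: negligibleS AN YY'.
have -> : Y' @^-1` B = ((Y @^-1` B) `\` N) `|` ((Y' @^-1` B) `&` N).
  apply/seteqP; split => w /=.
    by move=> YB; have [e|n] := pselect (Y w = Y' w); [left; split => //; rewrite e|right].
  by case=> [[YB /contrapT <-]//|[]].
have h : @measurable _ (g_sigma_algebraType G) ((Y @^-1` B) `\` N).
  apply: (@measurableD _ (g_sigma_algebraType G)); [exact: mY|exact: GN].
apply: (@measurableU _ (g_sigma_algebraType G)); first exact: h.
by apply: GN => w [].
Qed.

Lemma ae_measurable_fun (Y Y' : O -> R) : measurable_fun setT Y ->
  {ae P, forall w, Y w = Y' w} -> measurable_fun setT Y'.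
Proof.
move=> mY YY' _ B mB; rewrite setTI.
pose N := [set w | Y w <> Y' w].
have GN A : A `<=` N -> measurable A.
  by move=> AN; apply: Pc; exact: negligibleS AN YY'.
have -> : Y' @^-1` B = ((Y @^-1` B) `\` N) `|` ((Y' @^-1` B) `&` N).
  apply/seteqP; split => w /=.
    by move=> YB; have [e|n] := pselect (Y w = Y' w); [left; split => //; rewrite e|right].
  by case=> [[YB /contrapT <-]//|[]].
apply: measurableU; last by apply: GN => w [].
apply: measurableD; last exact: GN.
by rewrite -[X in measurable X]setTI; exact: mY.
Qed.

Lemma ae_integrable (Y Y' : O -> R) : Int Y ->
  {ae P, forall w, Y w = Y' w} -> Int Y'.
Proof.
move=> iY YY'; have mY' := ae_measurable_fun (integrable_EFin_fun iY) YY'.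
move/integrableP : (iY) => [_ h]; apply/integrableP; split; first exact/measurable_EFinP.
rewrite (ae_eq_integral (fun w => `|(Y w)%:E|%E))//.
- by apply/measurable_EFinP; apply: measurableT_comp.
- by apply/measurable_EFinP; apply: measurableT_comp => //; exact: integrable_EFin_fun.
- by apply: filterS YY' => w -> _.
Qed.

Lemma cond_exp_ae X Y Y' : CE X Y -> {ae P, forall w, Y w = Y' w} -> CE X Y'.
Proof.
move=> [mY iY eY] YY'; split; first exact: sub_measurable_ae YY'.
  exact: ae_integrable YY'.
move=> A GA; have mA := sigma_gen_measurable GA; rewrite -eY//; apply: ae_eq_integral => //.
- apply/measurable_EFinP; apply: measurable_funTS.
  by apply: (ae_measurable_fun (integrable_EFin_fun iY)).
- by apply/measurable_EFinP; apply: measurable_funTS; exact: integrable_EFin_fun.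
- by apply: filterS YY' => w -> _.
Qed.

Lemma sub_measurable_lim (Y_ : nat -> O -> R) (Y : O -> R) :
  (forall n, sub_measurable (Y_ n)) ->
  {ae P, forall w, Y_ n w @[n --> \oo] --> Y w} -> sub_measurable Y.
Proof.
move=> mY [N [mN PN NY]].
have GN : @measurable _ (g_sigma_algebraType G) (~` N).
  by apply: (@measurableC _ (g_sigma_algebraType G)); apply: Gnull.
pose Y' w := Y w * \1_(~` N) w.
apply: (@sub_measurable_ae Y').
  apply/sub_measurableE.
  apply: (@measurable_fun_cvg _ (g_sigma_algebraType G) R setT (fun n w => Y_ n w * \1_(~` N) w)).
    move=> n; apply: measurable_funM; first exact/sub_measurableE.
    exact: measurable_indic.
  move=> w _; rewrite /Y' indicE; case: (boolP (w \in ~` N)) => wN.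
    rewrite mulr1; under eq_cvg do rewrite mulr1.
    by apply: contrapT => nc; move/set_mem : wN; apply; exact: NY.
  by rewrite mulr0; under eq_cvg do rewrite mulr0; exact: cvg_cst.
exists N; split => // w /= h; apply: contrapT => nN; apply: h.
by rewrite /Y' indicE mem_set// mulr1.
Qed.

Lemma ae_le_integrable (f S : O -> R) : measurable_fun setT f -> Int S ->
  {ae P, forall w, `|f w| <= S w} -> Int f.
Proof.
move=> mf iS fS; apply/integrableP; split; first exact/measurable_EFinP.
have mS := integrable_EFin_fun iS.
move/integrableP : (iS) => [_]; apply: le_lt_trans.
apply: ae_ge0_le_integral => //.
- by apply/measurable_EFinP; exact: measurableT_comp.
- by apply/measurable_EFinP; exact: measurableT_comp.
- by apply: filterS fS => w h _ /=; rewrite lee_fin (le_trans h)// ler_norm.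
Qed.

End CondExp.

(** * Limits of conditional expectations and the pull-out property *)

Section CondExpLim.
Import HBNNSimple.
Context {R : realType} d (O : measurableType d) (P : probability O R).
Variable G : set (set O).
Hypothesis GM : G `<=` measurable.
Hypothesis Pc : measure_is_complete P.
Hypothesis Gnull : null_sets P `<=` <<s G >>.
Local Notation CE := (is_cond_exp P <<s G >>).
Local Notation Int f := (P.-integrable setT (EFin \o f)).

Lemma sigma_measurable : <<s @measurable _ O >> = @measurable _ O.
Proof. by apply: sigma_algebra_id; exact: sigma_algebra_measurable. Qed.

Lemma measurable_fun_ae_lim (Y_ : nat -> O -> R) (Y : O -> R) :
  (forall n, measurable_fun setT (Y_ n)) ->
  {ae P, forall w, Y_ n w @[n --> \oo] --> Y w} -> measurable_fun setT Y.
Proof.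
move=> mY cY; apply: (@sub_measurable_fun _ _ O measurable) => //.
apply: (sub_measurable_lim Pc _ _ cY) => //.
  by rewrite sigma_measurable => A [].
by move=> n B mB; rewrite sigma_measurable -[X in measurable X]setTI; exact: mY.
Qed.

(** The [X_ n] are dominated by [S], hence the [Y_ n] by the conditional expectation of [S].
    Dominated convergence over each test set carries the defining identity to the limit. *)
Lemma cond_exp_lim (X_ Y_ : nat -> O -> R) (X Y S : O -> R) :
  Int S -> (forall n, measurable_fun setT (X_ n)) ->
  {ae P, forall w, forall n, `|X_ n w| <= S w} ->
  (forall n, CE (X_ n) (Y_ n)) ->
  {ae P, forall w, X_ n w @[n --> \oo] --> X w} ->
  {ae P, forall w, Y_ n w @[n --> \oo] --> Y w} ->
  Int X /\ CE X Y.
Proof.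
move=> iS mX XS cXY Xcv Ycv.
have mX' : measurable_fun setT X by exact: measurable_fun_ae_lim Xcv.
have iXn n : Int (X_ n).
  by apply: (ae_le_integrable (mX n) iS); apply: filterS XS.
have [CS cS] := cond_exp_exists GM iS.
have [mCS iCS eCS] := cS.
have YS : {ae P, forall w, forall n, `|Y_ n w| <= CS w}.
  apply: ae_foralln => n; apply: (cond_exp_norm_le GM (iXn n) iS (cXY n) cS).
  by apply: filterS XS.
have mYn n : measurable_fun setT (Y_ n).
  by case: (cXY n) => + _ _; exact: sub_measurable_fun.
have GY : sub_measurable G Y.
  by apply: (sub_measurable_lim Pc Gnull _ Ycv) => n; case: (cXY n).
have mY := sub_measurable_fun GM GY.
have DC (A : set O) (F_ : nat -> O -> R) (F D : O -> R) :
      measurable A -> (forall n, measurable_fun setT (F_ n)) ->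
    measurable_fun setT F -> Int D -> {ae P, forall w, forall n, `|F_ n w| <= D w} ->
    {ae P, forall w, F_ n w @[n --> \oo] --> F w} ->
    P.-integrable A (EFin \o F) /\
    (\int[P]_(w in A) (F_ n w)%:E @[n --> \oo] --> \int[P]_(w in A) (F w)%:E)%E.
  move=> mA mF_ mF iD FD Fcv.
  have [] := @dominated_convergence _ _ _ P A mA (fun n => EFin \o F_ n) (EFin \o F) (EFin \o D).
  - by move=> n; apply/measurable_EFinP; exact: measurable_funTS.
  - by apply/measurable_EFinP; exact: measurable_funTS.
  - by apply: filterS Fcv => w h _; apply: cvg_EFin => //; apply: nearW.
  - exact: integrable_sub_set.
  - by apply: filterS FD => w h n _; rewrite lee_fin.
  by move=> h _ h'; split.
have [iX _] := DC setT _ _ _ measurableT mX mX' iS XS Xcv.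
have [iY _] := DC setT _ _ _ measurableT mYn mY iCS YS Ycv.
split=> //; split => // A GA; have mA := sigma_gen_measurable GM GA.
have [_ cX] := DC A _ _ _ mA mX mX' iS XS Xcv.
have [_ cY] := DC A _ _ _ mA mYn mY iCS YS Ycv.
have E : (fun n => \int[P]_(w in A) (Y_ n w)%:E)%E = (fun n => \int[P]_(w in A) (X_ n w)%:E)%E.
  by apply/funext => n; case: (cXY n) => _ _; apply.
rewrite E in cY.
exact: cvg_unique cY cX.
Qed.

Local Notation fnO h := ((h : g_sigma_algebraType G -> R) : O -> R).

Lemma ge0_integral_sub_mul_simple (u : O -> R) (h : {nnsfun (g_sigma_algebraType G) >-> R}) :
  (forall w, 0 <= u w) -> measurable_fun setT u ->
  (\int[P]_w (fnO h w * u w)%:E =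
   \sum_(r \in range h) r%:E * \int[P]_(w in fnO h @^-1` [set r]) (u w)%:E)%E.
Proof.
move=> u0 mu.
have mr r : measurable (fnO h @^-1` [set r]).
  by apply: (sigma_gen_measurable GM); exact: (@measurable_sfunP _ _ (g_sigma_algebraType G)).
transitivity (\int[P]_w (\sum_(r \in range h) (r * \1_(fnO h @^-1` [set r]) w * u w)%:E))%E.
  apply: eq_integral => w _; rewrite fimfunE mulr_fsuml// -fsumEFin//.
have mm r : measurable_fun setT (fun w : O => (r * \1_(fnO h @^-1` [set r]) w * u w)%:E).
  apply/measurable_EFinP; apply: measurable_funM => //.
  by apply: measurable_funM => //; exact: measurable_indic.
rewrite ge0_integral_fsum//.
- apply: eq_fsbigr => r /set_mem[w _ <-].
  rewrite -ge0_integralZl//.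
  + rewrite [RHS]integral_mkcond; apply: eq_integral => x _.
    by rewrite patchE indicE; case: ifPn => _; rewrite ?mulr1 ?mulr0 ?mul0r.
  + exact/measurable_EFinP/measurable_funTS.
  + by move=> x _; rewrite lee_fin.
  + by rewrite lee_fin.
- move=> r w _; rewrite lee_fin mulr_ge0//.
  by rewrite indicE; case: (boolP (_ \in _)) => [/set_mem <-|_]; rewrite ?mulr1 ?mulr0.
Qed.

(* Pull-out property: an identity between the measures [f P] and [g P] on the
   sub-sigma-algebra extends from indicators to nonnegative densities. *)
Lemma ge0_integral_sub_mul (y f g : O -> R) :
  sub_measurable G y -> (forall w, 0 <= y w) ->
  (forall w, 0 <= f w) -> (forall w, 0 <= g w) -> measurable_fun setT f -> measurable_fun setT g ->
  (forall A, <<s G >> A -> (\int[P]_(w in A) (f w)%:E = \int[P]_(w in A) (g w)%:E)%E) ->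
  (\int[P]_w (y w * f w)%:E = \int[P]_w (y w * g w)%:E)%E.
Proof.
move=> my y0 f0 g0 mf mg fg.
have my' : measurable_fun setT (EFin \o y : g_sigma_algebraType G -> \bar R).
  by apply/measurable_EFinP; exact/sub_measurableE.
have [h [hnd hcv]] := @approximation _ (g_sigma_algebraType G) R setT measurableT (EFin \o y) my'
  (fun w _ => y0 w).
have mh n : measurable_fun setT (fnO (h n)).
  by apply: (sub_measurable_fun GM); apply/sub_measurableE.
have key (u : O -> R) : (forall w, 0 <= u w) -> measurable_fun setT u ->
    (\int[P]_w (y w * u w)%:E = limn (fun n => \int[P]_w (fnO (h n) w * u w)%:E))%E.
  move=> u0 mu.
  rewrite -monotone_convergence//; last 3 first.
  - by move=> n; apply/measurable_EFinP; exact: measurable_funM.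
  - by move=> n x _; rewrite lee_fin mulr_ge0.
  - move=> x _ m n mn; rewrite lee_fin ler_wpM2r//.
    by have /lefP := hnd _ _ mn; apply.
  apply: eq_integral => x _; apply/esym.
  under [in LHS]eq_fun do rewrite EFinM.
  apply: cvg_lim => //.
  by have := @cvgeZr nat \oo R (fun n => (fnO (h n) x)%:E) (y x)%:E (u x)%:E isT (hcv x I).
rewrite !key//; congr (limn _); apply/funext => n.
rewrite !ge0_integral_sub_mul_simple//; apply: eq_fsbigr => r _.
congr (_ * _)%E; apply: fg; exact: (@measurable_sfunP _ _ (g_sigma_algebraType G)).
Qed.

End CondExpLim.

(** * Rational times and countable families of almost sure statements *)

Section Rationals.
Context {R : realType}.

Definition rationals : set R := range (ratr : rat -> R).

Lemma dense_rationals : dense_set rationals.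
Proof.
by move=> a b /rat_in_itvoo[q]; rewrite in_itv/= => h; exists (ratr q); split => //; exists q.
Qed.

(** Chains of rational times are thereby indexed by the countable type [seq rat], so that one null
    set serves all of them. *)
Lemma rational_chain (x : R) s : (forall y, y \in x :: s -> rationals y) ->
  exists q : seq rat, x :: s = map ratr q.
Proof.
move: (x :: s) => {x}s; elim: s => [|x s IH] xs; first by exists [::].
have [q _ qx] : rationals x by apply: xs; rewrite inE eqxx.
have [|r ->] := IH; first by move=> y ys; apply: xs; rewrite inE ys orbT.
by exists (q :: r); rewrite /= qx.
Qed.

Lemma rlim_seq (D : set R) f t l (u : nat -> R) : rlim D f t l ->
  (forall n, D (u n) /\ t < u n < t + n.+1%:R^-1) -> f (u n) @[n --> \oo] --> l.
Proof.
move=> h hu; apply/cvgrPdist_lt => e /h[eta [eta0 H]].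
have [n hn] := exists_invS_lt eta0; exists n => // m /= nm; have [Dm /andP[m1 m2]] := hu m.
rewrite distrC; apply: H => //; rewrite m1/= (lt_trans m2)// ltrD2l (le_lt_trans _ hn)//.
exact: ler_invS.
Qed.

Lemma llim_seq (D : set R) f t l (u : nat -> R) : llim D f t l ->
  (forall n, D (u n) /\ t - n.+1%:R^-1 < u n < t) -> f (u n) @[n --> \oo] --> l.
Proof.
move=> h hu; apply/cvgrPdist_lt => e /h[eta [eta0 H]].
have [n hn] := exists_invS_lt eta0; exists n => // m /= nm; have [Dm /andP[m1 m2]] := hu m.
rewrite distrC; apply: H => //; rewrite m2 andbT (lt_trans _ m1)// ltrD2l ltrN2 (le_lt_trans _ hn)//.
exact: ler_invS.
Qed.

Lemma rlim_sub (D D' : set R) f t l : D `<=` D' -> rlim D' f t l -> rlim D f t l.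
Proof. by move=> DD h e /h[eta [e0 H]]; exists eta; split => // x /DD; exact: H. Qed.

Lemma llim_sub (D D' : set R) f t l : D `<=` D' -> llim D' f t l -> llim D f t l.
Proof. by move=> DD h e /h[eta [e0 H]]; exists eta; split => // x /DD; exact: H. Qed.

Lemma rational_seq_right (t : R) : exists u : nat -> R,
  forall n, rationals (u n) /\ t < u n < t + n.+1%:R^-1.
Proof.
have h (n : nat) : exists y, rationals y /\ t < y < t + n.+1%:R^-1; last first.
  by have [u hu] := choice h; exists u.
by apply: dense_rationals; rewrite ltrDl.
Qed.

Lemma rational_seq_left (t : R) : 0 < t -> exists u : nat -> R,
  forall n, [/\ rationals (u n), 0 < u n & t - n.+1%:R^-1 < u n < t].
Proof.
move=> t0.
have h (n : nat) : exists y, [/\ rationals y, 0 < y & t - n.+1%:R^-1 < y < t]; last first.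
  by have [u hu] := choice h; exists u.
have mt : Num.max 0 (t - n.+1%:R^-1) < t by rewrite gt_max t0/= ltrBlDr ltrDl.
have [x [Dx /andP[]]] := dense_rationals mt.
by rewrite gt_max => /andP[x0 tx] xt; exists x; rewrite tx xt.
Qed.

End Rationals.

Section Countable.
Context {R : realType} d (O : measurableType d) (P : probability O R).

Lemma ae_countable (I : countType) (A : I -> O -> Prop) :
  (forall i, {ae P, forall w, A i w}) -> {ae P, forall w, forall i, A i w}.
Proof.
move=> H; have : {ae P, forall w, forall n, if (unpickle n : option I) is Some i then A i w else True}.
  by apply: ae_foralln => n; case: unpickle => [i|]; [exact: H|exact: aeW].
by apply: filterS => w h i; have := h (pickle i); rewrite pickleK.
Qed.

Lemma ae_rational_chain (A : R -> seq R -> O -> Prop) :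
  (forall x s, (forall y, y \in x :: s -> rationals y) -> {ae P, forall w, A x s w}) ->
  {ae P, forall w, forall x s, (forall y, y \in x :: s -> rationals y) -> A x s w}.
Proof.
move=> H.
have : {ae P, forall w, forall (q : rat * seq rat), A (ratr q.1) (map ratr q.2) w}.
  apply: ae_countable => q; apply: H => y; rewrite -map_cons => /mapP[r _ ->]; by exists r.
apply: filterS => w h x s /rational_chain[[//|q r] /= [-> ->]]; exact: (h (q, r)).
Qed.

Lemma measurable_rational_chain (A : R -> seq R -> set O) :
  (forall x s, (forall y, y \in x :: s -> rationals y) -> measurable (A x s)) ->
  measurable [set w | forall x s, (forall y, y \in x :: s -> rationals y) -> A x s w].
Proof.
move=> H.
have -> : [set w | forall x s, (forall y, y \in x :: s -> rationals y) -> A x s w] =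
   \bigcap_(n in setT) (if (unpickle n : option (rat * seq rat)) is Some q
                                then A (ratr q.1) (map ratr q.2) else setT).
  apply/seteqP; split => [w h n _|w h x s].
    case: unpickle => [[q r]|//] /=; apply: h => y; rewrite -map_cons => /mapP[z _ ->]; by exists z.
  move=> /rational_chain[[//|q r] /= [-> ->]]; have := h (pickle (q, r)) I; by rewrite pickleK.
apply: bigcapT_measurable => n; case: unpickle => [[q r]|] //=; apply: H => y.
by rewrite -map_cons => /mapP[z _ ->]; exists z.
Qed.

Lemma measurable_tvar (X : R -> O -> R) e x s :
  (forall y, y \in x :: s -> measurable_fun setT (X y)) ->
  measurable_fun setT (fun w => tvar e (X ^~ w) x s).
Proof.
elim: s x => [|y s IH] x xs //=.
apply: measurable_funD; last by apply: IH => z zs; apply: xs; rewrite inE zs orbT.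
apply: measurable_maxr => //; apply: measurable_funB => //.
apply: measurableT_comp => //; apply: measurable_funB; apply: xs.
  by rewrite !inE eqxx orbT.
by rewrite inE eqxx.
Qed.

End Countable.

Section CondExpProcess.
Context {R : realType} d (O : measurableType d) (P : probability O R).
Variable G : set (set O).
Hypothesis GM : G `<=` measurable.
Hypothesis Pc : measure_is_complete P.
Hypothesis Gnull : null_sets P `<=` <<s G >>.
Local Notation CE := (is_cond_exp P <<s G >>).
Local Notation Int f := (P.-integrable setT (EFin \o f)).

Lemma integrable_fun_add (f g : O -> R) : Int f -> Int g -> Int (fun w => f w + g w).
Proof. by move=> fi gi; exact: (integrableD _ fi gi). Qed.
Lemma integrable_fun_sub (f g : O -> R) : Int f -> Int g -> Int (fun w => f w - g w).
Proof. by move=> fi gi; exact: (integrableB _ fi gi). Qed.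
Lemma integrable_fun_norm (f : O -> R) : Int f -> Int (fun w => `|f w|).
Proof. by move=> fi; exact: (integrable_abse fi). Qed.
Lemma integrable_fun_scale (c : R) (f : O -> R) : Int f -> Int (fun w => c * f w).
Proof. by move=> fi; exact: (integrableZl _ c fi). Qed.
Lemma integrable_fun_cst (c : R) : Int (fun _ : O => c).
Proof. exact: finite_measure_integrable_cst. Qed.

Variable X M : R -> O -> R.
Variable I : set R.
Hypothesis iX : forall x, I x -> Int (X x).
Hypothesis cM : forall x, I x -> CE (X x) (M x).

Lemma integrable_tvar0 x s : (forall y, y \in x :: s -> I y) ->
  Int (fun w => tvar 0 (X ^~ w) x s).
Proof.
elim: s x => [|y s IH] x xs; first exact: integrable_fun_cst.
rewrite (_ : (fun w => _) = (fun w => `|X y w - X x w| + tvar 0 (X ^~ w) y s)); last first.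
  by apply/funext => w; rewrite tvar0_cons.
apply: integrable_fun_add; last by apply: IH => z zs; apply: xs; rewrite inE zs orbT.
apply: integrable_fun_norm; apply: integrable_fun_sub; apply: iX; apply: xs.
  by rewrite !inE eqxx orbT.
by rewrite inE eqxx.
Qed.

(** Each increment of [M] is the conditional expectation of the increment of [X], so its absolute
    value is at most the conditional expectation of the absolute increment; these bounds add up
    along the chain. *)
Lemma cond_exp_tvar0_le x s Z : (forall y, y \in x :: s -> I y) ->
  CE (fun w => tvar 0 (X ^~ w) x s) Z ->
  {ae P, forall w, tvar 0 (M ^~ w) x s <= Z w}.
Proof.
elim: s x Z => [|y s IH] x Z xs cZ.
  have := cond_exp_unique GM (cond_exp_cst P G 0) cZ.
  by apply: filterS => w <-.
have Ix : I x by apply: xs; rewrite inE eqxx.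
have Iy : I y by apply: xs; rewrite !inE eqxx orbT.
have ys z : z \in y :: s -> I z by move=> zs; apply: xs; rewrite inE zs orbT.
have i1 : Int (fun w => X y w - X x w) by apply: integrable_fun_sub; exact: iX.
have i1' := integrable_fun_norm i1.
have i2 := integrable_tvar0 ys.
have [Z1 c1] := cond_exp_exists GM i1'.
have [Z2 c2] := cond_exp_exists GM i2.
have cZ' : CE (fun w => tvar 0 (X ^~ w) x (y :: s)) (fun w => Z1 w + Z2 w).
  have := cond_expD GM i1' i2 c1 c2.
  by congr (is_cond_exp _ _ _ _); apply/funext => w; rewrite tvar0_cons.
have h1 := cond_exp_unique GM cZ cZ'.
have h2 := IH y Z2 ys c2.
have h3 := cond_exp_norm_le GM i1 i1' (cond_expB GM (iX Iy) (iX Ix) (cM Iy) (cM Ix)) c1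
  (aeW _ (fun w => lexx _)).
by apply: filterS3 h1 h2 h3 => w -> H2 H3; rewrite tvar0_cons lerD.
Qed.

End CondExpProcess.

(** * Càdlàg conditional expectations for a fixed sigma-algebra *)

Section CondExpCadlag.
Context {R : realType} d (O : measurableType d) (P : probability O R).
Variable G : set (set O).
Hypothesis GM : G `<=` measurable.
Hypothesis Pc : measure_is_complete P.
Hypothesis Gnull : null_sets P `<=` <<s G >>.
Local Notation CE := (is_cond_exp P <<s G >>).
Local Notation Int f := (P.-integrable setT (EFin \o f)).

(** The event [C j] that every [Y k] is at least [j.+1%:R^-1] lies in the sigma-algebra. Over it
    [Y k] and [T_ k] have the same integral, which tends to zero by dominated convergence, so [C j]
    is null. *)
Lemma cond_exp_tail (S : O -> R) (T_ Y : nat -> O -> R) : Int S ->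
  (forall k, measurable_fun setT (T_ k)) -> (forall k w, 0 <= T_ k w <= S w) ->
  (forall w, T_ k w @[k --> \oo] --> 0) -> (forall k, CE (T_ k) (Y k)) ->
  {ae P, forall w, forall e, 0 < e -> exists k, Y k w < e}.
Proof.
move=> iS mT TS T0 cY.
pose C j := [set w | forall k, j.+1%:R^-1 <= Y k w].
have GC j : <<s G >> (C j).
  have -> : C j = \bigcap_(k in setT) (Y k @^-1` `[j.+1%:R^-1, +oo[%classic).
    by apply/seteqP; split => w h k; [move=> _|]; rewrite /= ?in_itv/= ?andbT; have := h k; rewrite /= ?in_itv/= ?andbT//; apply.
  apply: (@bigcapT_measurable _ (g_sigma_algebraType G)) => k.
  by case: (cY k) => + _ _; apply; exact: measurable_itv.
have PC j : P (C j) = 0%E.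
  have mC := sigma_gen_measurable GM (GC j).
  have h : (\int[P]_(w in C j) (T_ k w)%:E @[k --> \oo] --> 0)%E.
    rewrite -[X in _ --> X](@integral0 _ _ _ P (C j)).
    have [] // := @dominated_convergence _ _ _ P (C j) mC (fun k => EFin \o T_ k) (cst 0%E) (EFin \o S).
    - by move=> k; apply/measurable_EFinP; exact: measurable_funTS.
    - by apply: aeW => w _; apply: (cvg_EFin _ (T0 w)); exact: nearW.
    - exact: integrable_sub_set.
    - by apply: aeW => w k _; rewrite /= lee_fin ger0_norm; case/andP: (TS k w).
  have le0 : ((j.+1%:R^-1)%:E * P (C j) <= 0)%E.
    rewrite -(cvg_lim _ h)//; apply: lime_ge; first by apply/cvg_ex; exists 0%E.
    apply: nearW => k.
    have [mY iY eY] := cY k.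
    rewrite -(eY _ (GC j)) -integral_cst//; apply: le_integral => //.
    - exact: (finite_measure_integrable_cst _ _ mC).
    - exact: integrable_sub_set.
    - by move=> w /set_mem; rewrite lee_fin; apply.
  apply/eqP; rewrite eq_le measure_ge0 andbT.
  by move: le0; rewrite pmule_rle0// lte_fin invr_gt0.
have : {ae P, forall w, forall j, ~ C j w}.
  apply: ae_foralln => j; exists (C j); split; first exact: (sigma_gen_measurable GM).
    exact: PC.
  by move=> w /= /contrapT.
apply: filterS => w h e e0; have [j hj] := exists_invS_lt e0.
have /existsNP[k /negP hk] := h j; exists k; apply: (lt_trans _ hj).
by rewrite ltNge.
Qed.

Lemma process_integrable (X : R -> O -> R) (S : nat -> O -> R) t :
  (forall t, 0 <= t -> measurable_fun setT (X t)) -> (forall n, Int (S n)) ->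
  {ae P, forall w, forall n t, 0 <= t <= n%:R -> `|X t w| <= S n w} ->
  0 <= t -> Int (X t).
Proof.
move=> mX iS XS t0; pose n := (Num.truncn t).+1.
apply: (ae_le_integrable (mX t t0) (iS n)); apply: filterS XS => w; apply.
by rewrite t0 ltW// /n truncnS_gt.
Qed.

(* The variation of [E[X|G]] along a rational chain of [m] steps is at most
   [m / j.+1 + k + 2 m E[S 1_{V > k}|G]], where [V] is the [j.+1^-1]-truncated variation
   of [X], finite because the paths are càdlàg. The last expectation is small for [k]
   large, so that [E[X|G]] has boundedly many jumps of a given size along the rationals. *)
Lemma cond_exp_cadlag (X : R -> O -> R) (S : nat -> O -> R) :
  (forall t, 0 <= t -> measurable_fun setT (X t)) -> (forall w, cadlag (X ^~ w)) ->
  (forall n, Int (S n)) -> (forall n w, 0 <= S n w) ->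
  {ae P, forall w, forall n t, 0 <= t <= n%:R -> `|X t w| <= S n w} ->
  exists N : R -> O -> R, [/\ forall w, cadlag (N ^~ w),
    (forall t, 0 <= t -> CE (X t) (N t)) &
    (forall t, 0 < t -> CE (fun w => left_lim (X ^~ w) t) (fun w => left_lim (N ^~ w) t))].
Proof.
move=> mX cX iS S0 XS.
have iX t (t0 : 0 <= t) := process_integrable mX iS XS t0.
have /choice[M cM] : forall t, exists Y, 0 <= t -> CE (X t) Y.
  move=> t; have [t0|_] := leP 0 t; last by exists (cst 0).
  by have [Y cY] := cond_exp_exists GM (iX t t0); exists Y.
pose chain (n : nat) (x : R) (s : seq R) := path <=%R x s /\ (forall y, y \in x :: s -> 0 <= y <= n%:R).
pose B (n j k : nat) := [set w | forall (x : R) s, (forall y, y \in x :: s -> rationals y) ->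
  chain n x s -> tvar j.+1%:R^-1 (X ^~ w) x s <= k%:R].
have mB n j k : measurable (B n j k).
  rewrite /B; apply: (@measurable_rational_chain _ _ _ (fun x s => [set w | chain n x s -> _])) => x s rxs.
  have [ch|nc] := pselect (chain n x s); last first.
    by rewrite (_ : [set w | _] = setT)//; apply/seteqP; split => // w _ /nc.
  rewrite (_ : [set w | _] = (fun w => tvar j.+1%:R^-1 (X ^~ w) x s) @^-1` `]-oo, k%:R]); last first.
    by apply/seteqP; split => w; rewrite /= in_itv/= => // /(_ ch).
  rewrite -[Y in measurable Y]setTI; apply: measurable_tvar => //.
  by case: ch => _ xs y /xs /andP[y0 _]; exact: mX.
(* The part of the dominating variable on which the truncated variation exceeds [k]. Rational chains
   in the definition of [B] make the event measurable. *)
pose T_ n j k w := S n w * \1_(~` B n j k) w.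
have mT n j k : measurable_fun setT (T_ n j k).
  apply: measurable_funM; first exact: integrable_EFin_fun.
  by apply: measurable_indic; exact: measurableC.
have iT n j k : Int (T_ n j k).
  apply: (ae_le_integrable (mT n j k) (iS n)); apply: aeW => w; rewrite /T_ indicE.
  by case: (_ \in _); rewrite ?mulr1 ?mulr0 ?normr0// ger0_norm.
have /choice[Y cY] : forall p : nat * nat * nat, exists Y, CE (T_ p.1.1 p.1.2 p.2) Y.
  by move=> p; exact: cond_exp_exists.
have tail : {ae P, forall w, forall p : nat * nat, forall e, 0 < e -> exists k, Y (p.1, p.2, k) w < e}.
  apply: ae_countable => -[n j] /=; apply: (cond_exp_tail (iS n) (mT n j)) => //.
  - move=> k w; rewrite /T_ indicE.
    by case: (_ \in _); rewrite ?mulr1 ?mulr0 S0 ?lexx.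
  - move=> w; have j0 : 0 < j.+1%:R^-1 :> R by rewrite invr_gt0.
    have [K bK] := cadlag_tvb j0 (cX w) (ler0n R n).
    apply/cvgrPdist_lt => e e0; near=> k.
    rewrite /T_ indicE memNset ?mulr0 ?subrr ?normr0// => -[]; rewrite /B /= => x s _ [ps xs].
    apply: (le_trans (bK x s ps _)).
      by move=> y ys; rewrite /= in_itv/=; exact: xs.
    by near: k; apply: nbhs_infty_ger.
  - by move=> k; exact: (cY (n, j, k)).
have bound : {ae P, forall w, forall p : nat * nat * nat, forall (x : R) s,
    (forall y, y \in x :: s -> rationals y) -> chain p.1.1 x s ->
    tvar 0 (M ^~ w) x s <= p.1.2.+1%:R^-1 *+ size s + p.2%:R + (size s)%:R * 2 * Y p w}.
  apply: ae_countable => -[[n j] k] /=; apply: ae_rational_chain => x s rxs.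
  have [[ps xs]|nc] := pselect (chain n x s); last by apply: aeW => w /nc.
  have xs0 y : y \in x :: s -> [set y | 0 <= y] y by move=> /xs /andP[].
  have iV := integrable_tvar0 iX xs0.
  have [Z cZ] := cond_exp_exists GM iV.
  have h1 := cond_exp_tvar0_le GM iX cM xs0 cZ.
  (* On [B n j k] the first summand bounds the variation of [X] along the chain, by [tvar0_le]. Off
     it each increment is at most [2 * S n w]. *)
  pose W w := (j.+1%:R^-1 *+ size s + k%:R) + (size s)%:R * 2 * T_ n j k w.
  have iW : Int W.
    apply: integrable_fun_add; first exact: integrable_fun_cst.
    exact: integrable_fun_scale.
  have h2 := cond_exp_le GM iV iW cZ (cond_expD GM (integrable_fun_cst P _)
    (integrable_fun_scale _ (iT n j k)) (cond_exp_cst P G _) (cond_expZ GM _ (iT n j k) (cY (n, j, k)))).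
  suff hW : {ae P, forall w, tvar 0 (X ^~ w) x s <= W w}.
    by apply: filterS2 h1 (h2 hW) => w H1 H2 _; exact: le_trans H1 H2.
  apply: filterS XS => w hw; rewrite /W /T_ indicE.
  case: (boolP (w \in ~` B n j k)) => [_|/negP wB].
    rewrite mulr1.
    have : tvar 0 (X ^~ w) x s <= (size s)%:R * 2 * S n w.
      move: (xs); clear -hw; elim: s x => [|y s IH] x xs; first by rewrite /= mulr0n !mul0r.
      rewrite tvar0_cons /= -natr1 !mulrDl mul1r addrC; apply: lerD.
        by apply: IH => z zs; apply: xs; rewrite inE zs orbT.
      apply: (le_trans (ler_normB _ _)).
      have := hw n x (xs x (mem_head _ _)).
      have := hw n y (xs y ltac:(by rewrite !inE eqxx orbT)).
      lra.
    move=> /le_trans; apply; rewrite lerDr addr_ge0// mulrn_wge0//.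
  rewrite mulr0 mulr0 addr0.
  have wB' : B n j k w by apply: contrapT => h; apply: wB; exact: mem_set.
  have j0 : 0 <= j.+1%:R^-1 :> R by rewrite invr_ge0.
  by apply: (le_trans (tvar0_le _ _ _ j0)); rewrite lerD2l; apply: wB'.
have good : {ae P, forall w, (forall t, 0 <= t -> exists l, rlim rationals (M ^~ w) t l) /\
    (forall t, 0 < t -> exists l, llim rationals (M ^~ w) t l)}.
  apply: filterS2 tail bound => w tl bd.
  have key n delta : 0 < delta -> exists m, forall x s, path (jumps delta (M ^~ w)) x s ->
      (forall y, y \in x :: s -> rationals y) ->
      (forall y, y \in x :: s -> 0 <= y <= n%:R) -> (size s <= m)%N.
    move=> delta0; have d40 : 0 < delta / 4 by rewrite divr_gt0.
    have [j hj] := exists_invS_lt d40.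
    have [k hk] := tl (n, j) _ ltac:(exact: (divr_gt0 delta0 (ltr0n R 8))).
    exists (Num.truncn (k%:R * 2 / delta)).+1 => x s pj rxs xs.
    have h := bd (n, j, k) x s rxs (conj (path_jumps_le pj) xs).
    have h' := tvar0_jumps pj.
    have s0 : 0 <= (size s)%:R :> R by exact: ler0n.
    have h1 : (size s)%:R * (j.+1%:R^-1) <= (size s)%:R * (delta / 4) :> R by exact: ler_wpM2l (ltW hj).
    have h2 : (size s)%:R * Y (n, j, k) w <= (size s)%:R * (delta / 8) :> R by exact: ler_wpM2l (ltW hk).
    have h3 : (size s)%:R <= k%:R * 2 / delta.
      rewrite ler_pdivlMr//; move: h h' => /=; rewrite -[_ *+ size s]mulr_natl -[delta *+ _]mulr_natl.
      rewrite -mulrA [2 * _]mulrC mulrA.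
      move: h1 h2; set a := _%:R * j.+1%:R^-1; set b := _ * Y _ w; set c := (size s)%:R * delta.
      rewrite [_ * (delta / 4)]mulrA [_ * (delta / 8)]mulrA -/c; lra.
    by rewrite -(ler_nat R) (le_trans h3)// ltW// truncnS_gt.
  split=> t t0.
    apply: bounded_jumps_rlim; first exact: dense_rationals.
    move=> delta delta0; have [m hm] := key (Num.truncn (t + 1)).+1 _ delta0.
    exists m => x s pj xs; apply: (hm x s pj) => [y /xs[]//|y /xs[_ /andP[ty yt]]].
    by rewrite (le_trans t0 (ltW ty))/= ltW// (lt_trans yt)// truncnS_gt.
  apply: bounded_jumps_llim => //; first exact: dense_rationals.
  move=> delta delta0; have [m hm] := key (Num.truncn t).+1 _ delta0.
  exists m => x s pj xs; apply: (hm x s pj) => [y /xs[]//|y /xs[_ /andP[ty yt]]].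
  by rewrite (ltW ty)/= ltW// (lt_trans yt)// truncnS_gt.
have /choice[N hN] : forall w, exists g, cadlag g /\
   ((forall t, 0 <= t -> exists l, rlim rationals (M ^~ w) t l) /\
    (forall t, 0 < t -> exists l, llim rationals (M ^~ w) t l) ->
    (forall t, 0 <= t -> rlim rationals (M ^~ w) t (g t)) /\
    (forall t, 0 < t -> llim rationals (M ^~ w) t (left_lim g t))).
  move=> w; have [[h1 h2]|h] := pselect ((forall t, 0 <= t -> exists l, rlim rationals (M ^~ w) t l) /\
    (forall t, 0 < t -> exists l, llim rationals (M ^~ w) t l)).
    by have [g [? ? ?]] := regularization dense_rationals h1 h2; exists g; split.
  exists (cst 0); split => //; split => t t0; first exact: cvg_cst.
  by apply/cvg_ex; exists 0; exact: cvg_cst.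
exists (fun t w => N w t); split.
- by move=> w; have [] := hN w.
(* [N t] is a limit of [M] at rationals to the right of [t], not [M t] itself. It is a version of
   the conditional expectation because [X (u k)] tends to [X t] by right-continuity. *)
- move=> t t0; have [u hu] := rational_seq_right t.
  have u0 n : 0 <= u n by have [_ /andP[/ltW tu _]] := hu n; exact: le_trans tu.
  pose n := (Num.truncn (t + 1)).+1.
  have [] // := @cond_exp_lim _ _ _ P G GM Pc Gnull (fun k => X (u k)) (fun k => M (u k))
    (X t) (fun w => N w t) (S n) (iS n).
  + by move=> k; exact: mX.
  + apply: filterS XS => w h k; apply: h; rewrite u0/=.
    have [_ /andP[_ uk]] := hu k; apply: (le_trans (ltW uk)); rewrite (@le_trans _ _ (t + 1))//.
      by rewrite lerD2l invf_le1// ler1n.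
    by rewrite ltW// truncnS_gt.
  + by move=> k; exact: cM.
  + apply: aeW => w; have /cadlagP[h _] := cX w; apply: (rlim_seq (h t t0)) => k.
    by split => //; have [] := hu k.
  + by apply: filterS good => w gw; have [_ /(_ gw)[h _]] := hN w; exact: (rlim_seq (h t t0)).
- move=> t t0; have [u hu] := rational_seq_left t0.
  have u0 n : 0 <= u n by have [_ /ltW] := hu n.
  pose n := (Num.truncn t).+1.
  have [] // := @cond_exp_lim _ _ _ P G GM Pc Gnull (fun k => X (u k)) (fun k => M (u k))
    (fun w => left_lim (X ^~ w) t) (fun w => left_lim (N w) t) (S n) (iS n).
  + by move=> k; exact: mX.
  + apply: filterS XS => w h k; apply: h; rewrite u0/=.
    by have [_ _ /andP[_ uk]] := hu k; apply: (le_trans (ltW uk)); rewrite ltW// truncnS_gt.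
  + by move=> k; exact: cM.
  + apply: aeW => w; have /cadlagP[_ h] := cX w; apply: (llim_seq (h t t0)) => k.
    by split => //; have [] := hu k.
  + apply: filterS good => w gw; have [_ /(_ gw)[_ h]] := hN w; apply: (llim_seq (h t t0)) => k.
    by have [? _ ?] := hu k.
Unshelve. all: by end_near.
Qed.

End CondExpCadlag.

(** * Finite variation and lower bounds for conditional probabilities *)

Section CondExpVariation.
Context {R : realType} d (O : measurableType d) (P : probability O R).
Variable G : set (set O).
Hypothesis GM : G `<=` measurable.
Hypothesis Gnull : null_sets P `<=` <<s G >>.
Local Notation CE := (is_cond_exp P <<s G >>).
Local Notation Int f := (P.-integrable setT (EFin \o f)).

Lemma cond_exp_bounded_variation (X N : R -> O -> R) (V : nat -> O -> R) :
  (forall t, 0 <= t -> Int (X t)) -> (forall w, cadlag (N ^~ w)) ->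
  (forall t, 0 <= t -> CE (X t) (N t)) -> (forall n, Int (V n)) ->
  {ae P, forall w, forall n (x : R) s, (forall y, y \in x :: s -> rationals y) ->
     path <=%R x s -> (forall y, y \in x :: s -> 0 <= y <= n%:R) ->
     tvar 0 (X ^~ w) x s <= V n w} ->
  {ae P, forall w, forall n : nat, exists K, tvb 0 (N ^~ w) `[0, n%:R] K}.
Proof.
move=> iX cN cXN iV XV.
have /choice[Z cZ] : forall n, exists Y, CE (V n) Y by move=> n; exact: cond_exp_exists.
have : {ae P, forall w, forall n (x : R) s, (forall y, y \in x :: s -> rationals y) ->
     path <=%R x s /\ (forall y, y \in x :: s -> 0 <= y <= n%:R) ->
     tvar 0 (N ^~ w) x s <= Z n w}.
  apply: ae_foralln => n; apply: ae_rational_chain => x s rxs.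
  have [[ps xs]|nc] := pselect (path <=%R x s /\ (forall y, y \in x :: s -> 0 <= y <= n%:R)); last first.
    by apply: aeW => w /nc.
  have xs0 y : y \in x :: s -> [set y | 0 <= y] y by move=> /xs /andP[].
  have iT := integrable_tvar0 iX xs0.
  have [Y cY] := cond_exp_exists GM iT.
  have h1 := cond_exp_tvar0_le GM iX cXN xs0 cY.
  have hV : {ae P, forall w, tvar 0 (X ^~ w) x s <= V n w}.
    by apply: filterS XV => w h; exact: h.
  have h2 := cond_exp_le GM iT (iV n) cY (cZ n) hV.
  by apply: filterS2 h1 h2 => w a b _; exact: le_trans a b.
(* The index [n.+1] appears because [tvb_dense] moves chains in [[0, n]] to rational chains in
   [[0, n + 1]]. *)
apply: filterS => w h n; exists (Z n.+1 w).
have /cadlagP[rc _] := cN w.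
apply: (tvb_dense dense_rationals) => // x s px xs; apply: h.
  by move=> y /xs[].
split=> // y /xs[_] /=; by rewrite in_itv/= natr1.
Qed.

Lemma integral_indic_mul (f : O -> R) (A C : set O) :
  (\int[P]_(w in C) (f w * \1_A w)%:E = \int[P]_(w in C `&` A) (f w)%:E)%E.
Proof.
rewrite integral_mkcondr; apply: eq_integral => w _; rewrite patchE indicE.
by case: ifPn => _; rewrite ?mulr1 ?mulr0.
Qed.

Lemma integrable_indic_mul (f : O -> R) (A : set O) : measurable A -> Int f ->
  Int (fun w => f w * \1_A w).
Proof.
move=> mA fi; apply: (@le_integrable _ _ _ _ _ _ _ (EFin \o f)) => //.
  apply/measurable_EFinP; apply: measurable_funM; last exact: measurable_indic.
  exact: (integrable_EFin_fun fi).
by move=> w _; rewrite /= lee_fin indicE; case: (_ \in _); rewrite ?mulr1 ?mulr0 ?normr0.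
Qed.

Lemma integrable_indicator (A : set O) : measurable A -> Int (\1_A : O -> R).
Proof.
move=> mA; have := integrable_indic_mul mA (integrable_fun_cst P 1).
by congr (_.-integrable _ (_ \o _)); apply/funext => w; rewrite mul1r.
Qed.

(** The integral is the difference of the integrals of the positive and negative parts. As [f] and
    [g] are nonnegative, these parts come from those of [y], and the nonnegative case applies to
    each. *)
Lemma integral_sub_mul (y f g : O -> R) :
  sub_measurable G y ->
  (forall w, 0 <= f w) -> (forall w, 0 <= g w) -> measurable_fun setT f -> measurable_fun setT g ->
  (forall A, <<s G >> A -> (\int[P]_(w in A) (f w)%:E = \int[P]_(w in A) (g w)%:E)%E) ->
  (\int[P]_w (y w * f w)%:E = \int[P]_w (y w * g w)%:E)%E.
Proof.
move=> my f0 g0 mf mg fg.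
have mp : sub_measurable G (fun w => Num.max (y w) 0).
  by apply/sub_measurableE; apply: measurable_maxr => //; exact/sub_measurableE.
have mn : sub_measurable G (fun w => Num.max (- y w) 0).
  apply/sub_measurableE; apply: measurable_maxr => //; apply: measurableT_comp => //.
  exact/sub_measurableE.
have key (u : O -> R) : (forall w, 0 <= u w) ->
   (\int[P]_w (y w * u w)%:E =
     \int[P]_w (Num.max (y w) 0 * u w)%:E - \int[P]_w (Num.max (- y w) 0 * u w)%:E)%E.
  move=> u0; rewrite integralE; congr (_ - _)%E; apply: eq_integral => w _.
    rewrite funeposE; case: (leP (y w) 0) => yw.
      by rewrite mul0r max_r// lee_fin mulr_le0_ge0.
    by rewrite max_l// lee_fin mulr_ge0// ltW.
  rewrite funenegE -EFinN -mulNr; case: (leP (- y w) 0) => yw.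
    by rewrite mul0r max_r// lee_fin mulr_le0_ge0.
  by rewrite max_l// lee_fin mulr_ge0// ltW.
rewrite !key//; congr (_ - _)%E.
  by apply: (ge0_integral_sub_mul GM mp) => // w; rewrite le_max lexx orbT.
by apply: (ge0_integral_sub_mul GM mn) => // w; rewrite le_max lexx orbT.
Qed.

(* For every [e], the event [exists n, K n /\ D n < e] has probability at most [e]:
   let [K x] be the largest event of a finite subfamily. Where [D x < e], the union is
   contained in [A x], whose conditional probability is less than [e]. Where
   [e <= D x], the index [x] does not contribute and can be removed. *)
Lemma cond_exp_indic_lower_bound (K A : nat -> set O) (D : nat -> O -> R) :
  (forall n, measurable (K n)) -> (forall n, measurable (A n)) -> (forall n, K n `<=` A n) ->
  (forall m n, K m `<=` K n \/ K n `<=` K m) ->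
  (forall n, CE (\1_(A n)) (D n)) ->
  {ae P, forall w, exists e, 0 < e /\ forall n, K n w -> e <= D n w}.
Proof.
move=> mK mA KA Kt cD.
pose V e (s : seq nat) := [set w | exists2 n, n \in s & K n w /\ D n w < e].
have GD n e : <<s G >> [set w | D n w < e].
  have -> : [set w | D n w < e] = D n @^-1` `]-oo, e[ by apply/seteqP; split => w; rewrite /= in_itv.
  by case: (cD n) => + _ _; apply; exact: measurable_itv.
have mD n e : measurable [set w | D n w < e] := sigma_gen_measurable GM (GD n e).
have VE e s : V e s = \bigcup_(n in [set` s]) (K n `&` [set w | D n w < e]).
  by apply/seteqP; split => w [n ns h]; exists n.
have mV e s : measurable (V e s).
  by rewrite VE; apply: fin_bigcup_measurable => // n _; exact: measurableI.
have smax (s : seq nat) : s != [::] -> exists2 x, x \in s & forall y, y \in s -> K y `<=` K x.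
  elim: s => // x s IH _; have [->|/IH[z zs hz]] := eqVneq s [::].
    by exists x; rewrite ?inE// => y; rewrite inE => /eqP->.
  have [xz|zx] := Kt x z.
    by exists z; rewrite ?inE ?zs ?orbT// => y; rewrite inE => /orP[/eqP->//|]; exact: hz.
  exists x; rewrite ?inE ?eqxx// => y; rewrite inE => /orP[/eqP->//|/hz]; move=> h; exact: subset_trans zx.
(* The bound is localized to every [h] of the sigma-algebra because the induction on the length of
   [s] splits [h] along [D x < e]. *)
have PV e s h : 0 <= e -> <<s G >> h -> (P (h `&` V e s) <= e%:E * P h)%E.
  move=> e0; have [k] := ubnP (size s); elim: k s h => // k IH s h /ltnSE ks Gh.
  have mh := sigma_gen_measurable GM Gh.
  have [->|/smax[x xs hx]] := eqVneq s [::].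
    rewrite (_ : V e [::] = set0) ?setI0 ?measure0 ?mule_ge0 ?lee_fin//.
    by apply/seteqP; split => // w [].
  (* All occurrences of [x] are removed, so the length drops even if [s] has repetitions. *)
  pose s' := seq.filter (predC1 x) s.
  have ss' : (size s' < k)%N.
    apply: leq_trans ks; rewrite size_filter -(count_predC (predC1 x) s) -[X in (X < _)%N]addn0 ltn_add2l.
    by rewrite -has_count; apply/hasP; exists x => //=; rewrite negbK.
  pose h1 := h `&` [set w | D x w < e]; pose h2 := h `\` [set w | D x w < e].
  have Gh1 : <<s G >> h1 by apply: (@measurableI _ (g_sigma_algebraType G)) => //; exact: GD.
  have Gh2 : <<s G >> h2 by apply: (@measurableD _ (g_sigma_algebraType G)) => //; exact: GD.
  have mh1 := sigma_gen_measurable GM Gh1; have mh2 := sigma_gen_measurable GM Gh2.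
  have -> : P h = (P h1 + P h2)%E by rewrite addeC; exact: measureDI.
  have sub : h `&` V e s `<=` (h1 `&` A x) `|` (h2 `&` V e s').
    move=> w [hw [n ns [Kn Dn]]].
    have [Dx|Dx] := pselect (D x w < e).
      by left; split => //; apply: KA; exact: hx Kn.
    right; split => //; exists n => //; rewrite mem_filter ns andbT /=.
    by apply: contra_notN Dx => /eqP <-.
  apply: (@le_trans _ _ (P (h1 `&` A x) + P (h2 `&` V e s'))%E).
    apply: (@le_trans _ _ (P ((h1 `&` A x) `|` (h2 `&` V e s')))).
      by apply: le_measure; rewrite ?inE; [exact: measurableI|apply: measurableU; exact: measurableI|].
    by apply: measureU2; exact: measurableI.
  rewrite ge0_muleDr//; apply: leeD; last exact: IH.
  rewrite setIC -integral_indic//.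
  have [_ iD eD] := cD x.
  rewrite -[leLHS]eD// -integral_cst//; apply: le_integral => //.
  - exact: integrable_sub_set.
  - exact: (finite_measure_integrable_cst _ _ mh1).
  - by move=> w /set_mem[_ /= /ltW]; rewrite lee_fin.
pose U e := [set w | exists n, K n w /\ D n w < e].
have UE e : U e = \bigcup_n (V e (iota 0 n)).
  apply/seteqP; split => w /=.
    by move=> [n h]; exists n.+1 => //; exists n => //; rewrite mem_iota /= add0n ltnS.
  by move=> [n _ [k _ h]]; exists k.
have mU e : measurable (U e) by rewrite UE; exact: bigcupT_measurable.
have PU e : 0 <= e -> (P (U e) <= e%:E)%E.
  move=> e0.
  have := @nondecreasing_cvg_mu _ _ _ P (fun n => V e (iota 0 n)) (fun n => mV e _) _ _.
  rewrite -UE => /(_ (mU e)) h.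
  have {}h := h ltac:(by move=> m n mn; apply/subsetPset => w [k ks hk]; exists k => //; move: ks;
    rewrite !mem_iota !add0n /= => /leq_trans; apply).
  rewrite -(cvg_lim _ h)//; apply: lime_le; first by apply/cvg_ex; eexists; exact: h.
  apply: nearW => n /=; have := PV e (iota 0 n) setT e0 (@measurableT _ (g_sigma_algebraType G)).
  by rewrite setTI probability_setT mule1.
(* The exceptional set consists of the points where no [j.+1%:R^-1] is a lower bound; its
   probability is at most each [j.+1%:R^-1]. *)
exists (\bigcap_j (U j.+1%:R^-1)); split.
- exact: bigcapT_measurable.
- apply/eqP; rewrite eq_le measure_ge0 andbT; apply/lee_addgt0Pr => e e0; rewrite add0e.
  have [j hj] := exists_invS_lt e0.
  apply: (@le_trans _ _ (P (U j.+1%:R^-1))).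
    by apply: le_measure; rewrite ?inE//; [exact: bigcapT_measurable|exact: bigcap_inf].
  by apply: (le_trans (PU _ _)); rewrite ?lee_fin ?(ltW hj).
- move=> w /= h j _; apply: contrapT => nU; apply: h.
  exists j.+1%:R^-1; split; first by rewrite invr_gt0.
  by move=> n Kn; rewrite leNgt; apply/negP => Dn; apply: nU; exists n.
Qed.

End CondExpVariation.

Lemma measurable_inv (R : realType) : measurable_fun setT (GRing.inv : R -> R).
Proof.
rewrite -(setvU [set (0 : R)]); apply/(measurable_funU _ (measurableC (measurable_set1 _)) (measurable_set1 _)).
split.
  apply: open_continuous_measurable_fun; first 
    exact/closed_openC/accessible_closed_set1/hausdorff_accessible/Rhausdorff.
  by move=> x; rewrite inE /= => /eqP x0; exact: inv_continuous.
exact: measurable_fun_set1.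
Qed.

(** * Conditioning on the active pieces *)

Section TraceConditioning.
Context {R : realType} d dE (O : measurableType d) (E : measurableType dE).
Variable P : probability O R.
Hypothesis Pc : measure_is_complete P.
Variables (act : nat -> set O) (Z : nat -> O -> E) (good : set O).
Hypothesis mact : forall i, measurable (act i).
Hypothesis mZ : forall i, measurable_fun setT (Z i).
Hypothesis mgood : measurable good.
Hypothesis Pgood : P (~` good) = 0%E.
Local Notation Int f := (P.-integrable setT (EFin \o f)).

(** Common form of both information sigma-algebras: with [act] the pieces present at [t], or just
    before [t], it unfolds to the generator of [Ginfo] or [Ginfo_minus]. *)
Definition info_gen : set (set O) := [set A | exists i B, measurable B /\
  A = act i `&` (Z i @^-1` B)] `|` null_sets P.

Definition mark_gen (s : seq nat) : set (set O) := [set A | exists i B,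
  [/\ i \in s, measurable B & A = Z i @^-1` B]] `|` null_sets P.

Definition active_set (s : seq nat) : set O := good `&` [set w | forall i, act i w <-> i \in s].

Lemma info_gen_measurable : info_gen `<=` measurable.
Proof.
move=> A [[i [B [mB ->]]]|[]//]; apply: measurableI => //.
by rewrite -[X in measurable X]setTI; exact: mZ.
Qed.

Lemma mark_gen_measurable s : mark_gen s `<=` measurable.
Proof.
by move=> A [[i [B [_ mB ->]]]|[]//]; rewrite -[X in measurable X]setTI; exact: mZ.
Qed.

Lemma info_gen_null : null_sets P `<=` <<s info_gen >>.
Proof. by move=> A NA; apply: sub_sigma_algebra; right. Qed.

Lemma mark_gen_null s : null_sets P `<=` <<s mark_gen s >>.
Proof. by move=> A NA; apply: sub_sigma_algebra; right. Qed.

Lemma info_act i : <<s info_gen >> (act i).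
Proof. by apply: sub_sigma_algebra; left; exists i, setT; split => //; rewrite preimage_setT setIT. Qed.

Lemma info_active_set s : <<s info_gen >> (active_set s).
Proof.
have -> : active_set s = good `&` \bigcap_i (if i \in s then act i else ~` act i).
  apply/seteqP; split => w [gw h]; split => //.
    by move=> i _; case: ifPn => [/h//|/negP nis] /h.
  move=> i; have := h i I; case: ifPn => [_ //|/negP nis na]; split => // /na.
apply: (@measurableI _ (g_sigma_algebraType info_gen)).
  rewrite -[good]setCK; apply: (@measurableC _ (g_sigma_algebraType info_gen)).
  by apply: info_gen_null; split => //; exact: measurableC.
apply: (@bigcapT_measurable _ (g_sigma_algebraType info_gen)) => i.
case: ifPn => _; first exact: info_act.
by apply: (@measurableC _ (g_sigma_algebraType info_gen)); exact: info_act.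
Qed.

Lemma measurable_active_set s : measurable (active_set s).
Proof. exact: (sigma_gen_measurable info_gen_measurable (info_active_set s)). Qed.

(** On [active_set s] a generator with index in [s] reduces to its mark event and one with index
    outside [s] to the empty set. Agreement of traces is stable under complements and countable
    unions. *)
Lemma info_trace s C : <<s info_gen >> C ->
  exists2 H, <<s mark_gen s >> H & C `&` active_set s = H `&` active_set s.
Proof.
move: C; apply: smallest_sub; first split.
- by exists set0; [exact: (@measurable0 _ (g_sigma_algebraType (mark_gen s)))|].
- move=> C [H mH e]; exists (setT `\` H).
    by apply: (@measurableD _ (g_sigma_algebraType (mark_gen s))) => //;
     exact: (@measurableT _ (g_sigma_algebraType (mark_gen s))).
  rewrite !setTD; apply/seteqP; split => w [nC Aw]; split => // h; apply: nC.
    by have [] : (C `&` active_set s) w by rewrite e.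
  by have [] : (H `&` active_set s) w by rewrite -e.
- move=> F hF; have /choice[H hH] : forall n, exists H,
      <<s mark_gen s >> H /\ F n `&` active_set s = H `&` active_set s.
    by move=> n; have [H ? ?] := hF n; exists H.
  exists (\bigcup_n H n).
    by apply: (@bigcupT_measurable _ (g_sigma_algebraType (mark_gen s))) => n; have [] := hH n.
  rewrite !setI_bigcupl; apply: eq_bigcup => // n _; by have [] := hH n.
- move=> C [[i [B [mB ->]]]|NC]; last by exists C => //; exact: mark_gen_null.
  have [si|nsi] := boolP (i \in s).
    exists (Z i @^-1` B); first by apply: sub_sigma_algebra; left; exists i, B.
    apply/seteqP; split => w; first by move=> [[_ ?] ?].
    by move=> [Zw Aw]; split => //; split => //; apply/(Aw.2 i).
  exists set0; first exact: (@measurable0 _ (g_sigma_algebraType (mark_gen s))).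
  by rewrite set0I; apply/seteqP; split => // w [[/= aw _] Aw]; move/negP: nsi; apply; apply/(Aw.2 i).
Qed.

Lemma mark_trace s H : <<s mark_gen s >> H -> <<s info_gen >> (H `&` active_set s).
Proof.
move: H; apply: smallest_sub; first split.
- by rewrite /= set0I; exact: (@measurable0 _ (g_sigma_algebraType info_gen)).
- move=> C hC /=; rewrite (_ : _ `&` _ = active_set s `\` (C `&` active_set s)).
    by apply: (@measurableD _ (g_sigma_algebraType info_gen)) => //; exact: info_active_set.
  apply/seteqP; split => w; first by move=> [[_ nC] Aw]; split => // -[].
  by move=> [Aw nC]; split => //; split => // Cw; apply: nC.
- move=> F hF /=; rewrite setI_bigcupl.
  by apply: (@bigcupT_measurable _ (g_sigma_algebraType info_gen)).
- move=> C [[i [B [si mB ->]]]|NC] /=.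
    rewrite (_ : _ `&` _ = (act i `&` Z i @^-1` B) `&` active_set s).
      apply: (@measurableI _ (g_sigma_algebraType info_gen)); last exact: info_active_set.
      by apply: sub_sigma_algebra; left; exists i, B.
    apply/seteqP; split => w; last by move=> [[]].
    by move=> [Zw Aw]; split => //; split => //; apply/(Aw.2 i).
  apply: (@measurableI _ (g_sigma_algebraType info_gen)); last exact: info_active_set.
  exact: info_gen_null.
Qed.

(* Bayes formula: on the event that exactly the pieces in [s] are active, the
   available information reduces to the marks of these pieces. *)
Lemma trace_cond_exp s (X Y N D : O -> R) : Int X ->
  is_cond_exp P <<s info_gen >> X Y ->
  is_cond_exp P <<s mark_gen s >> (fun w => X w * \1_(active_set s) w) N ->
  is_cond_exp P <<s mark_gen s >> (\1_(active_set s)) D ->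
  {ae P, forall w, active_set s w -> Y w = N w / D w}.
Proof.
move=> iX cY cN cD; set A := active_set s.
have IM := info_gen_measurable; have MM := @mark_gen_measurable s.
have MN := @mark_gen_null s.
have mA : measurable A := measurable_active_set s.
have iA : Int (\1_A) := integrable_indicator P mA.
have iXA : Int (fun w => X w * \1_A w) := integrable_indic_mul mA iX.
have [mN iN eN] := cN; have [mD iD eD] := cD; have [mY iY eY] := cY.
have mNf := integrable_EFin_fun iN; have mDf := integrable_EFin_fun iD.
have D0 : {ae P, forall w, 0 <= D w}.
  apply: (cond_exp_le MM (integrable_fun_cst P 0) iA (cond_exp_cst P _ 0) cD).
  by apply: aeW => w; rewrite indicE.
(* The pull-out property asks for densities that are nonnegative everywhere, whereas [D] is so only
   almost surely. *)
pose D' w := Num.max 0 (D w).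
have DD' : {ae P, forall w, D w = D' w} by apply: filterS D0 => w h; rewrite /D' max_r.
have cD' := cond_exp_ae MM Pc MN cD DD'.
have [mD' iD' eD'] := cD'; have mD'f := integrable_EFin_fun iD'.
have D'0 w : 0 <= D' w by rewrite /D' le_max lexx.
pose y w := N w / D w.
have my : sub_measurable (mark_gen s) y.
  apply/sub_measurableE; apply: measurable_funM; first exact/sub_measurableE.
  by apply: (measurableT_comp (@measurable_inv R)); exact/sub_measurableE.
(* The active set meets the event [D = 0] in a null set, so the numerator vanishes there as well.
   Whatever value division by zero has, [y * D'] then equals [N] almost surely. *)
have N0 : {ae P, forall w, D w = 0 -> N w = 0}.
  pose Z0 := D @^-1` [set 0].
  have GZ0 : <<s mark_gen s >> Z0 by exact: mD.
  have mZ0 := sigma_gen_measurable MM GZ0.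
  have AZ0 : P (A `&` Z0) = 0%E.
    rewrite -integral_indic// -eD//; apply: integral0_eq => w; by rewrite /Z0 /= => ->.
  have nul H : <<s mark_gen s >> H -> (\int[P]_(w in H) (N w * \1_Z0 w)%:E = 0)%E.
    move=> GH; have mH := sigma_gen_measurable MM GH.
    rewrite integral_indic_mul eN; last exact: (@measurableI _ (g_sigma_algebraType (mark_gen s))).
    rewrite integral_indic_mul -/A.
    have mHZ : measurable ((H `&` Z0) `&` A) by apply: measurableI => //; exact: measurableI.
    apply: null_set_integral => //.
      by apply/measurable_EFinP; apply: measurable_funTS; exact: (integrable_EFin_fun iX).
    apply/eqP; rewrite -measure_le0 -AZ0; apply: le_measure; rewrite ?inE//; first exact: measurableI.
    by move=> w [[_ ?] ?].
  have h : {ae P, forall w, N w * \1_Z0 w = 0}.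
    apply: (sub_measurable_ae_eq MM).
    - apply/sub_measurableE; apply: measurable_funM; first exact/sub_measurableE.
      exact: measurable_indic.
    - by apply/sub_measurableE; exact: measurable_cst.
    - exact: integrable_indic_mul.
    - exact: integrable_fun_cst.
    - by move=> H GH; rewrite nul// integral0.
  by apply: filterS h => w + d0; rewrite indicE mem_set ?mulr1.
have yD : {ae P, forall w, y w * D' w = N w}.
  apply: filterS2 N0 DD' => w h <-; rewrite /y.
  have [d0|dN0] := eqVneq (D w) 0; first by rewrite d0 mulr0 h.
  by rewrite divfK.
have myf := sub_measurable_fun MM my.
have fA w : 0 <= \1_A w :> R by rewrite indicE.
have eAD B : <<s mark_gen s >> B -> (\int[P]_(w in B) (\1_A w)%:E = \int[P]_(w in B) (D' w)%:E)%E.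
  by move=> GB; rewrite eD'.
(* Pulling out [|y|] turns the integral of [|y|] over [A] into that of [|y| * D'], which is the
   integral of [|N|]. *)
have iyA : Int (fun w => y w * \1_A w).
  apply/integrableP; split.
    by apply/measurable_EFinP; apply: measurable_funM => //; exact: measurable_indic.
  have -> : (\int[P]_w `|(y w * \1_A w)%:E| = \int[P]_w (`|y w| * \1_A w)%:E)%E.
    by apply: eq_integral => w _; rewrite /= normrM (ger0_norm (fA w)).
  rewrite (ge0_integral_sub_mul MM _ _ fA D'0 _ mD'f eAD)//.
  - have [_] := integrableP _ _ _ iN; apply: le_lt_trans; rewrite le_eqVlt; apply/orP; left; apply/eqP.
    apply: ae_eq_integral => //.
    + by apply/measurable_EFinP; apply: measurable_funM => //; exact: measurableT_comp.
    + by apply/measurable_EFinP; exact: measurableT_comp.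
    + by apply: filterS yD => w h _; rewrite /= -h (normrM (y w) (D' w)) (ger0_norm (D'0 w)).
  - by apply/sub_measurableE; apply: measurableT_comp => //; exact/sub_measurableE.
have cyA : is_cond_exp P <<s info_gen >> (fun w => X w * \1_A w) (fun w => y w * \1_A w).
  split => //.
  (* The product is zero off [A], so the preimage of [B] contains the complement of [A] if [0] is in
     [B] and misses it otherwise. *)
  - move=> B mB; have [B0|B0] := pselect (B 0).
      rewrite (_ : _ @^-1` _ = ((y @^-1` B) `&` A) `|` ~` A).
        apply: (@measurableU _ (g_sigma_algebraType info_gen)); first by apply: mark_trace; exact: my.
        by apply: (@measurableC _ (g_sigma_algebraType info_gen)); exact: info_active_set.
      apply/seteqP; split => w; rewrite /= indicE.
        by have [Aw|nA] := pselect (A w); [rewrite mem_set// mulr1; left|right].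
      by move=> [[Bw Aw]|nA]; [rewrite mem_set// mulr1|rewrite memNset// mulr0].
    rewrite (_ : _ @^-1` _ = (y @^-1` B) `&` A); first by apply: mark_trace; exact: my.
    apply/seteqP; split => w; rewrite /= indicE.
      by have [Aw|nA] := pselect (A w); [rewrite mem_set// mulr1|rewrite memNset// mulr0].
    by move=> [Bw Aw]; rewrite mem_set// mulr1.
  (* [C] is replaced by [H], which has the same trace on [A]. Over [H] the function [X * \1_A]
     integrates like [N], and pulling out [y * \1_H] turns [\1_A] into [D'], with [y * D' = N]. *)
  - move=> C GC; have [H GH CH] := info_trace s GC.
    have mC := sigma_gen_measurable IM GC; have mH := sigma_gen_measurable MM GH.
    rewrite !integral_indic_mul -/A CH -!integral_indic_mul.
    rewrite -[in RHS]eN//.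
    have myH : sub_measurable (mark_gen s) (fun w => y w * \1_H w).
      by apply/sub_measurableE; apply: measurable_funM; [exact/sub_measurableE|exact: measurable_indic].
    have := integral_sub_mul MM myH fA D'0 (integrable_EFin_fun iA) mD'f eAD.
    rewrite -[X in (\int[P]_(w in X) (y w * _)%:E)%E]setTI -integral_indic_mul.
    rewrite -[X in (_ = \int[P]_(w in X) (N w)%:E)%E]setTI -integral_indic_mul.
    under eq_integral do rewrite -mulrA [\1_H _ * _]mulrC mulrA.
    move=> ->; apply: ae_eq_integral => //.
    + by apply/measurable_EFinP; do 2 apply: measurable_funM => //; exact: measurable_indic.
    + by apply/measurable_EFinP; apply: measurable_funM => //; exact: measurable_indic.
    + by apply: filterS yD => w h _; rewrite /= -h mulrAC.
have cYA : is_cond_exp P <<s info_gen >> (fun w => X w * \1_A w) (fun w => Y w * \1_A w).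
  split.
  - apply/sub_measurableE; apply: measurable_funM; first exact/sub_measurableE.
    by apply: measurable_indic; exact: info_active_set.
  - exact: integrable_indic_mul.
  - move=> C GC; rewrite !integral_indic_mul; apply: eY.
    by apply: (@measurableI _ (g_sigma_algebraType info_gen)) => //; exact: info_active_set.
have := cond_exp_unique IM cyA cYA; apply: filterS => w + Aw.
by rewrite indicE mem_set// !mulr1.
Qed.

End TraceConditioning.

(** * Lower bounds along intervals of constant active set *)

Section PositiveIntensity.
Context {R : realType} d (O : measurableType d) (P : probability O R).
Variable G : set (set O).
Hypothesis GM : G `<=` measurable.
Local Notation CE := (is_cond_exp P <<s G >>).

Lemma rational_enum : exists u : nat -> R, (forall n, rationals (u n) /\ 0 <= u n) /\
  forall x, rationals x -> 0 <= x -> exists n, u n = x.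
Proof.
exists (fun n => if unpickle n is Some q then if 0 <= (q : rat) then ratr q else 0 else 0); split.
  move=> n; case: unpickle => [q|]; last by split => //; exists 0; rewrite // rmorph0.
  by case: ifPn => q0; rewrite ?ler0q ?q0//; split => //; [exists q|exists 0; rewrite // rmorph0].
move=> _ [q _ <-]; rewrite ler0q => q0; exists (pickle q); by rewrite pickleK q0.
Qed.

Lemma cond_prob_locally_bounded_below (A : R -> set O) (D : R -> O -> R) :
  (forall t, 0 <= t -> measurable (A t)) -> (forall t, 0 <= t -> CE (\1_(A t)) (D t)) ->
  {ae P, forall w, forall q : R, rationals q -> 0 <= q -> exists e, 0 < e /\
    forall r, rationals r -> 0 <= r ->
    (forall v, rationals v -> q <= v <= r \/ r <= v <= q -> A v w) -> e <= D r w}.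
Proof.
move=> mA cD; have [u [hu us]] := rational_enum.
(* [K n k] stands for the times between [u n] and [u k]. The two sides of [u n] are treated
   separately, because the events are nested only on each side. *)
have main (K : nat -> nat -> set R) : (forall n k, K n k `<=` [set v | 0 <= v]) ->
    (forall n k l, K n k `<=` K n l \/ K n l `<=` K n k) ->
  (forall n k, K n k (u k) \/ K n k = set0) ->
  {ae P, forall w, forall n, exists e, 0 < e /\ forall k, K n k (u k) ->
    (forall v, rationals v -> K n k v -> A v w) -> e <= D (u k) w}.
  move=> K0 Kt Ku; apply: ae_foralln => n.
  (* If [u k] lies on the wrong side of [u n], then [K n k] is empty and the first clause makes the
     event empty, which keeps the family nested. *)
  pose KK k := [set w | K n k (u k) /\ forall v, rationals v -> K n k v -> A v w].
  have mKK k : measurable (KK k).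
    have -> : KK k = (if `[< K n k (u k) >] then setT else set0) `&`
       \bigcap_j (if `[< K n k (u j) >] then A (u j) else setT).
      apply/seteqP; split => w.
        move=> [h1 h2]; split; first by case: asboolP.
        by move=> j _; case: asboolP => // h; apply: h2 => //; have [] := hu j.
      move=> [h1 h2]; split; first by move: h1; case: asboolP.
      move=> v rv Kv; have [j uj] := us v rv (K0 _ _ _ Kv).
      by have := h2 j I; rewrite uj asboolT.
    apply: measurableI; first by case: ifP.
    apply: bigcapT_measurable => j; case: ifP => // _; apply: mA; by have [] := hu j.
  have := @cond_exp_indic_lower_bound _ _ _ P G GM KK (fun k => A (u k)) (fun k => D (u k)) mKK _ _ _ _.
  move=> /(_ _ _ _ _) h.
  apply: filterS (h _ _ _ _).
  - by move=> w [e [e0 he]]; exists e; split => // k h1 h2; exact: he.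
  - by move=> k; apply: mA; have [] := hu k.
  - by move=> k w [h1 h2]; apply: h2 => //; have [] := hu k.
  - move=> k l; have [h1|h1] := Kt n k l.
      have [kk|k0] := Ku n k; last by left => w []; rewrite k0.
      have [ll|l0] := Ku n l; last by right => w []; rewrite l0.
      by right => w [_ h2]; split => // v rv /h1; exact: h2.
    have [kk|k0] := Ku n k; last by left => w []; rewrite k0.
    have [ll|l0] := Ku n l; last by right => w []; rewrite l0.
    by left => w [_ h2]; split => // v rv /h1; exact: h2.
  - by move=> k; apply: cD; have [] := hu k.
have ax (x y y' : R) : [set v | 0 <= v /\ x <= v <= y] `<=` [set v | 0 <= v /\ x <= v <= y'] \/
    [set v | 0 <= v /\ x <= v <= y'] `<=` [set v | 0 <= v /\ x <= v <= y].
  have [h|/ltW h] := leP y y'; [left|right] => v [v0 /andP[xv vy]]; split => //; rewrite xv/=;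
    exact: le_trans h.
have ax' (x y y' : R) : [set v | 0 <= v /\ y <= v <= x] `<=` [set v | 0 <= v /\ y' <= v <= x] \/
    [set v | 0 <= v /\ y' <= v <= x] `<=` [set v | 0 <= v /\ y <= v <= x].
  have [h|/ltW h] := leP y y'; [right|left] => v [v0 /andP[xv vy]]; split => //; rewrite vy andbT;
    exact: le_trans xv.
have h1 : {ae P, forall w, forall n, exists e, 0 < e /\ forall k, [set v | 0 <= v /\ u n <= v <= u k] (u k) ->
    (forall v, rationals v -> [set v | 0 <= v /\ u n <= v <= u k] v -> A v w) -> e <= D (u k) w}.
  apply: (main (fun n k => [set v | 0 <= v /\ u n <= v <= u k])); first by move=> n k v [].
    by move=> n k l; exact: ax.
  move=> n k; have [h|h] := leP (u n) (u k); [left|right].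
    by split; [by have [] := hu k|rewrite h lexx].
  by apply/seteqP; split => // v [_ /andP[h1 h2]]; have := le_trans h1 h2; rewrite leNgt h.
have h2 : {ae P, forall w, forall n, exists e, 0 < e /\ forall k, [set v | 0 <= v /\ u k <= v <= u n] (u k) ->
    (forall v, rationals v -> [set v | 0 <= v /\ u k <= v <= u n] v -> A v w) -> e <= D (u k) w}.
  apply: (main (fun n k => [set v | 0 <= v /\ u k <= v <= u n])); first by move=> n k v [].
    by move=> n k l; exact: ax'.
  move=> n k; have [h|h] := leP (u k) (u n); [left|right].
    by split; [by have [] := hu k|rewrite h lexx].
  by apply/seteqP; split => // v [_ /andP[h1' h2']]; have := le_trans h1' h2'; rewrite leNgt h.
apply: filterS2 h1 h2 => w H1 H2 q rq q0; have [n qE] := us q rq q0.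
have [e1 [e10 he1]] := H1 n; have [e2 [e20 he2]] := H2 n.
exists (Num.min e1 e2); split; first by rewrite lt_min e10.
move=> r rr r0 H; have [k rE] := us r rr r0; rewrite ge_min -rE.
have [qr|rq'] := leP q r; apply/orP; [left|right].
  apply: he1; first by rewrite /= rE qE r0 qr lexx.
  by move=> v rv [_ /=]; rewrite qE rE => h; apply: H => //; left.
apply: he2; first by rewrite /= rE qE r0 (ltW rq') lexx.
by move=> v rv [_ /=]; rewrite qE rE => h; apply: H => //; right.
Qed.

End PositiveIntensity.

(** * Integrable domination by a possibly nonmeasurable bound *)

Section Domination.
Context {R : realType} d (O : measurableType d) (P : probability O R).
Local Notation Int f := (P.-integrable setT (EFin \o f)).

(** [f] will be a supremum over uncountably many times or a total variation, whose measurability is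
    not at hand. The countable supremum [F] of the [g j] is measurable and below [f], and the
    integral of nonnegative functions, a supremum over simple functions below, is monotone all the
    same. *)
Lemma dominating_integrable (J : countType) (g : J -> O -> R) (f : O -> \bar R) :
  (forall j, measurable_fun setT (g j)) -> (forall j w, 0 <= g j w) ->
  (forall j w, ((g j w)%:E <= f w)%E) -> (forall w, (0 <= f w)%E) -> (\int[P]_w f w < +oo)%E ->
  exists V : O -> R, [/\ Int V, forall w, 0 <= V w & {ae P, forall w, forall j, g j w <= V w}].
Proof.
move=> mg g0 gf f0 fi.
pose h n w : \bar R := if unpickle n is Some j then (g j w)%:E else 0%E.
pose F w := esups (h ^~ w) 0.
have hF n w : (h n w <= F w)%E by apply: ereal_sup_ubound; exists n.
have h0 n w : (0 <= h n w)%E by rewrite /h; case: unpickle => // j; rewrite lee_fin.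
have F0 w : (0 <= F w)%E by apply: le_trans (hF 0%N w).
have Ff w : (F w <= f w)%E.
  by apply: ub_ereal_sup => _ [n _ <-]; rewrite /h; case: unpickle.
have mF : measurable_fun setT F.
  apply: measurable_fun_esups => n; rewrite /h; case: unpickle => // j.
  exact/measurable_EFinP.
have iF : (\int[P]_w F w < +oo)%E.
  apply: le_lt_trans fi; rewrite !ge0_integralTE//.
  by apply: le_ereal_sup => _ [k hk <-]; exists k => // x; exact: le_trans (hk x) (Ff x).
have IF : P.-integrable setT F.
  by apply/integrableP; split => //; under eq_integral do rewrite gee0_abs//.
have fin := integrable_ae measurableT IF.
exists (fun w => fine (F w)); split.
- apply: (@le_integrable _ _ _ _ _ _ _ F) => //.
    by apply/measurable_EFinP; exact: measurableT_comp.
  move=> w _; rewrite /= gee0_abs// ger0_norm ?fine_ge0//.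
  by move: (F0 w); case: (F w) => [r| |] //= _; rewrite leey.
- by move=> w; rewrite fine_ge0.
- apply: filterS fin => w /(_ I) Fw j; rewrite -lee_fin fineK//.
  by have := hF (pickle j) w; rewrite /h pickleK.
Qed.

End Domination.

(** * Arrival and deletion times *)

Section JumpTimes.
Context {R : realType} d (O : measurableType d) (P : probability O R).
Variable T : nat -> O -> \bar R.
Hypothesis mT : forall i, measurable_fun setT (T i).
Hypothesis Pc : measure_is_complete P.
Hypothesis T_count : forall t : R, 0 <= t ->
  (\int[P]_w (\sum_(0 <= i <oo) ((T i w <= t%:E)%E%:R)%:E) < +oo)%E.
Local Notation Int f := (P.-integrable setT (EFin \o f)).

Definition present (t : R) (i : nat) : set O := [set w | (T i.*2 w <= t%:E < T i.*2.+1 w)%E].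
Definition present_left (t : R) (i : nat) : set O := [set w | (T i.*2 w < t%:E <= T i.*2.+1 w)%E].

Definition jump_count (t : R) (w : O) : \bar R := (\sum_(0 <= i <oo) ((T i w <= t%:E)%E%:R)%:E)%E.

Definition regular : set O := [set w | forall n : nat, (jump_count n%:R w < +oo)%E].

Lemma measurable_T_le t i : measurable [set w | (T i w <= t%:E)%E].
Proof. by rewrite -[X in measurable X]setTI; exact: emeasurable_fun_infty_c. Qed.

Lemma measurable_T_lt t i : measurable [set w | (T i w < t%:E)%E].
Proof. by rewrite -[X in measurable X]setTI; exact: emeasurable_fun_infty_o. Qed.

Lemma measurable_present t i : measurable (present t i).
Proof.
rewrite (_ : present t i = [set w | (T i.*2 w <= t%:E)%E] `\` [set w | (T i.*2.+1 w <= t%:E)%E]).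
  by apply: measurableD; exact: measurable_T_le.
apply/seteqP; split => w; rewrite /present /=.
  by move=> /andP[-> h]; split => //; apply/negP; rewrite -ltNge.
by move=> [-> /negP]; rewrite -ltNge.
Qed.

Lemma measurable_present_left t i : measurable (present_left t i).
Proof.
rewrite (_ : present_left t i = [set w | (T i.*2 w < t%:E)%E] `\` [set w | (T i.*2.+1 w < t%:E)%E]).
  by apply: measurableD; exact: measurable_T_lt.
apply/seteqP; split => w; rewrite /present_left /=.
  by move=> /andP[-> h]; split => //; apply/negP; rewrite -leNgt.
by move=> [-> /negP]; rewrite -leNgt.
Qed.

Lemma measurable_jump_count t : measurable_fun setT (jump_count t).
Proof.
apply: ge0_emeasurable_sum => [i w _ _|i _]; first by rewrite lee_fin.
apply/measurable_EFinP.
rewrite (_ : (fun w => _) = \1_[set w | (T i w <= t%:E)%E]).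
  by apply: measurable_indic; exact: measurable_T_le.
apply/funext => w; rewrite indicE; congr (_%:R); congr nat_of_bool.
by apply/idP/idP => [h|/set_mem//]; exact: mem_set.
Qed.

Lemma jump_count_ge0 t w : (0 <= jump_count t w)%E.
Proof. by apply: nneseries_ge0 => i _ _; rewrite lee_fin. Qed.

Lemma integrable_jump_count t : 0 <= t -> P.-integrable setT (jump_count t).
Proof.
move=> t0; apply/integrableP; split; first exact: measurable_jump_count.
by under eq_integral do rewrite gee0_abs ?jump_count_ge0//; exact: T_count.
Qed.

Lemma measurable_regular : measurable regular.
Proof.
rewrite (_ : regular = \bigcap_n [set w | (jump_count n%:R w < +oo)%E]).
  apply: bigcapT_measurable => n.
  by rewrite -[X in measurable X]setTI; apply: emeasurable_fun_infty_o => //; exact: measurable_jump_count.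
by apply/seteqP; split => w h n; [move=> _|]; apply: h.
Qed.

Lemma regular_ae : {ae P, forall w, regular w}.
Proof.
apply: ae_foralln => n; apply: filterS (integrable_ae measurableT (integrable_jump_count (ler0n R n))).
by move=> w /(_ I); rewrite ge0_fin_numE// jump_count_ge0.
Qed.

Lemma regular_full : P (~` regular) = 0%E.
Proof. by apply/negligibleP; [apply: measurableC; exact: measurable_regular|exact: regular_ae]. Qed.

Lemma jump_count_le (s t : R) w : s <= t -> (jump_count s w <= jump_count t w)%E.
Proof.
move=> st; apply: lee_nneseries => [i _ _|i _]; rewrite lee_fin// ler_nat.
by case: (leP (T i w) s%:E) => // /le_trans ->; rewrite // lee_fin.
Qed.

Lemma jump_count_fin w t : regular w -> jump_count t w \is a fin_num.
Proof.
move=> rw; rewrite ge0_fin_numE ?jump_count_ge0//.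
apply: le_lt_trans (rw (Num.truncn t).+1); apply: jump_count_le.
by rewrite ltW// truncnS_gt.
Qed.

(** The index [j] contributes zero at [s] and one at [t], while no other term decreases. *)
Lemma jump_count_jump (s t : R) w j : s <= t -> (s%:E < T j w <= t%:E)%E ->
  (jump_count s w + 1 <= jump_count t w)%E.
Proof.
move=> st /andP[sj jt].
have -> : (jump_count s w + 1 = \sum_(0 <= i <oo) (((T i w <= s%:E)%E%:R)%:E + ((i == j)%:R)%:E))%E.
  rewrite nneseriesD; last 2 first.
  - by move=> i _ _; rewrite lee_fin.
  - by move=> i _ _; rewrite lee_fin.
  congr (_ + _)%E; rewrite (@nneseriesD1 _ _ j)//.
  by rewrite eqxx eseries0 ?adde0// => i _ /negPf ->.
apply: lee_nneseries => [i _ _|i _]; first by rewrite -EFinD lee_fin addr_ge0.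
rewrite -EFinD lee_fin; have [->|ij] := eqVneq i j.
  by rewrite jt [(T j w <= s%:E)%E]leNgt sj add0r.
rewrite addr0 ler_nat; case: (leP (T i w) s%:E) => // /le_trans ->; rewrite // lee_fin.
Qed.

(** Otherwise the partial sums of the count at [t] would exceed every integer. *)
Lemma regular_bounded_index w t : regular w -> exists N, forall j, (T j w <= t%:E)%E -> (j < N)%N.
Proof.
move=> rw; apply: contrapT => /forallNP C.
have {}C N : exists2 j, (N <= j)%N & (T j w <= t%:E)%E.
  apply: contrapT => nj; apply: (C N) => j Tj; rewrite ltnNge; apply/negP => Nj.
  by apply: nj; exists j.
have key k : exists N, (k%:R%:E <= \sum_(0 <= i < N) ((T i w <= t%:E)%E%:R)%:E :> \bar R)%E.
  elim: k => [|k [N hN]]; first by exists 0%N; rewrite big_geq.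
  have [j Nj Tj] := C N; exists j.+1.
  rewrite (@big_cat_nat _ _ _ N)//=; last exact: leqW.
  rewrite -natr1 EFinD; apply: leeD => //.
  rewrite big_nat_recr//= Tj; apply: leeDr; apply: sume_ge0 => i _; by rewrite lee_fin.
have := jump_count_fin t rw; rewrite ge0_fin_numE ?jump_count_ge0// => fin.
have [k hk] : exists k : nat, (jump_count t w < k%:R%:E)%E.
  have := jump_count_fin t rw; case: (jump_count t w) => // r _.
  by exists (Num.truncn r).+1; rewrite lte_fin truncnS_gt.
have [N hN] := key k; have := lt_le_trans hk hN; rewrite ltNge => /negP; apply.
by apply: nneseries_lim_ge => i _ _; rewrite lee_fin.
Qed.

(** Only finitely many of the times are at most [t + 1], and [eta] is chosen by induction over them;
    [eta <= 1] takes care of the remaining ones. *)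
Lemma regular_isolated w (t : R) : regular w -> exists eta : R, 0 < eta /\
  forall j, ~ (t%:E < T j w < (t + eta)%:E)%E /\ ~ ((t - eta)%:E < T j w < t%:E)%E.
Proof.
move=> rw; have [N hN] := regular_bounded_index (t + 1) rw.
have [eta [eta0 eta1 H]] : exists eta : R, [/\ 0 < eta, eta <= 1 & forall j, (j < N)%N ->
   ~ (t%:E < T j w < (t + eta)%:E)%E /\ ~ ((t - eta)%:E < T j w < t%:E)%E].
  elim: N {hN} => [|N [eta [eta0 eta1 H]]]; first by exists 1.
  have [e [e0 He]] : exists e : R, 0 < e /\ 
      (~ (t%:E < T N w < (t + e)%:E)%E /\ ~ ((t - e)%:E < T N w < t%:E)%E).
    case: (T N w) => [r| |]; last 2 first.
    - by exists 1; split => //; split => /andP[].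
    - by exists 1; split => //; split => /andP[].
    have [->|rt] := eqVneq r t.
      by exists 1; split => //; split; rewrite !lte_fin ltxx ?andbF.
    exists `|r - t|; split; first by rewrite normr_gt0 subr_eq0.
    rewrite !lte_fin; split => /andP[h1 h2].
      by move: h2; rewrite gtr0_norm ?subr_gt0//; lra.
    by move: h1; rewrite ltr0_norm ?subr_lt0//; lra.
  exists (Num.min eta e); split; first by rewrite lt_min eta0.
    by rewrite ge_min eta1.
  move=> j; rewrite ltnS leq_eqVlt => /orP[/eqP ->|/H[H1 H2]].
    case: He => He1 He2; split => /andP[h1 h2]; [apply: He1|apply: He2]; rewrite ?h1 ?h2 ?andbT/=.
      by apply: (lt_le_trans h2); rewrite lee_fin lerD2l ge_min lexx orbT.
    by apply: (le_lt_trans _ h1); rewrite lee_fin lerD2l lerN2 ge_min lexx orbT.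
  split => /andP[h1 h2]; [apply: H1|apply: H2]; rewrite ?h1 ?h2 ?andbT/=.
    by apply: (lt_le_trans h2); rewrite lee_fin lerD2l ge_min lexx.
  by apply: (le_lt_trans _ h1); rewrite lee_fin lerD2l lerN2 ge_min lexx.
exists eta; split => // j; have [/H//|Nj] := ltnP j N.
have Tj : (t%:E + 1 < T j w)%E by rewrite ltNge; apply/negP => /hN; rewrite ltnNge Nj.
split => /andP[h1 h2].
  have := lt_trans Tj h2; rewrite -EFinD lte_fin; lra.
by have := lt_trans Tj h2; rewrite -EFinD lte_fin; lra.
Qed.

Lemma present_right w t : regular w -> exists eta : R, 0 < eta /\
  forall u, t <= u < t + eta -> forall i, present u i w <-> present t i w.
Proof.
move=> rw; have [eta [eta0 H]] := regular_isolated t rw; exists eta; split => // u /andP[tu ut] i.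
have E j : (T j w <= u%:E)%E = (T j w <= t%:E)%E.
  apply/idP/idP => [h|/le_trans]; last by apply; rewrite lee_fin.
  rewrite leNgt; apply/negP => tj; have [+ _] := H j; apply.
  by rewrite tj (le_lt_trans h)// lte_fin.
by rewrite /present /= E !ltNge E.
Qed.

(** With no time in []t - eta, t[], the condition [T j w <= u] means [T j w < t]. This exchange of
    weak and strict inequalities produces the form of the left information. *)
Lemma present_leftP w t : regular w -> exists eta : R, 0 < eta /\
  forall u, t - eta < u < t -> forall i, present u i w <-> present_left t i w.
Proof.
move=> rw; have [eta [eta0 H]] := regular_isolated t rw; exists eta; split => // u /andP[tu ut] i.
have E j : (T j w <= u%:E)%E = (T j w < t%:E)%E.
  apply/idP/idP => [h|tj]; first by apply: le_lt_trans h _; rewrite lte_fin.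
  rewrite leNgt; apply/negP => uj; have [_] := H j; apply.
  by rewrite tj andbT (lt_trans _ uj)// lte_fin.
by rewrite /present /present_left /= E [X in _ && X]ltNge E -leNgt.
Qed.

Lemma present_code w t : regular w ->
  exists s : seq nat, forall i, present t i w <-> i \in s.
Proof.
move=> rw; have [N hN] := regular_bounded_index t rw.
exists [seq i <- iota 0 N | `[< present t i w >]] => i.
rewrite mem_filter mem_iota /= add0n; split=> [pi|/andP[/asboolP//]].
apply/andP; split; first exact/asboolP.
case/andP: pi => /hN + _; apply: leq_ltn_trans.
by rewrite -addnn leq_addr.
Qed.

Lemma present_left_code w t : regular w ->
  exists s : seq nat, forall i, present_left t i w <-> i \in s.
Proof.
move=> rw; have [N hN] := regular_bounded_index t rw.
exists [seq i <- iota 0 N | `[< present_left t i w >]] => i.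
rewrite mem_filter mem_iota /= add0n; split=> [pi|/andP[/asboolP//]].
apply/andP; split; first exact/asboolP.
case/andP: pi => /ltW/hN + _; apply: leq_ltn_trans.
by rewrite -addnn leq_addr.
Qed.

Definition mark_event (s : seq nat) (t : R) : set O := active_set (present t) regular s.
Definition mark_event_left (s : seq nat) (t : R) : set O := active_set (present_left t) regular s.

Lemma mark_event_right w s t : regular w -> exists eta : R, 0 < eta /\
  forall u, t <= u < t + eta -> mark_event s u w <-> mark_event s t w.
Proof.
move=> rw; have [eta [eta0 H]] := present_right t rw; exists eta; split => // u tu.
by split => -[_ h]; split => // i; rewrite -h; [apply: iff_sym|]; exact: H.
Qed.

Lemma mark_event_leftP w s t : regular w -> exists eta : R, 0 < eta /\
  forall u, t - eta < u < t -> mark_event s u w <-> mark_event_left s t w.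
Proof.
move=> rw; have [eta [eta0 H]] := present_leftP t rw; exists eta; split => // u tu.
by split => -[_ h]; split => // i; rewrite -h; [apply: iff_sym|]; exact: H.
Qed.

Lemma indicP (A B : set O) w w' : (A w <-> B w') -> \1_A w = \1_B w' :> R.
Proof.
move=> AB; rewrite !indicE; have [Aw|nA] := pselect (A w).
  by rewrite !mem_set//; exact/AB.
by rewrite !memNset// => /AB.
Qed.

(** If no time falls in []a, b]] the active set is the same at both ends; otherwise the count rises
    by at least one, which bounds any difference of indicators. *)
Lemma mark_event_variation w s (a b : R) : regular w -> a <= b ->
  `|\1_(mark_event s b) w - \1_(mark_event s a) w| <=
  fine (jump_count b w) - fine (jump_count a w) :> R.
Proof.
move=> rw ab; have fa := jump_count_fin a rw; have fb := jump_count_fin b rw.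
have [[j hj]|nj] := pselect (exists j, (a%:E < T j w <= b%:E)%E).
  apply: (@le_trans _ _ 1).
    by rewrite !indicE; do 2 case: (_ \in _); rewrite ?subrr ?subr0 ?sub0r ?normrN ?normr0 ?normr1.
  have := jump_count_jump ab hj; rewrite -(fineK fa) -(fineK fb) -EFinD lee_fin; lra.
rewrite (@indicP (mark_event s b) (mark_event s a) w w).
  by rewrite subrr normr0 subr_ge0 fine_le// jump_count_le.
have E j : (T j w <= b%:E)%E = (T j w <= a%:E)%E.
  apply/idP/idP => [h|/le_trans]; last by apply; rewrite lee_fin.
  by rewrite leNgt; apply/negP => aj; apply: nj; exists j; rewrite aj.
have H i : present b i w <-> present a i w by rewrite /present /= E !ltNge E.
by split => -[_ h]; split => // i; rewrite -h; [apply: iff_sym|]; exact: H.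
Qed.

Lemma rlim_mul_locally_constant (D : set R) (f g : R -> R) t l c (eta : R) : 0 < eta ->
  rlim D f t l -> (forall u, t < u < t + eta -> g u = c) ->
  rlim D (fun u => f u * g u) t (l * c).
Proof.
move=> eta0 h gc e e0.
have c1 : 0 < `|c| + 1 by rewrite ltr_wpDl.
have [eta' [eta'0 H]] := h (e / (`|c| + 1)) (divr_gt0 e0 c1).
exists (Num.min eta eta'); split; first by rewrite lt_min eta0.
move=> x Dx /andP[tx]; rewrite -ltrBlDl lt_min => /andP[x1 x2].
rewrite gc ?tx/= -?ltrBlDl// -mulrBl normrM.
have := H x Dx; rewrite tx -ltrBlDl => /(_ x2); rewrite ltr_pdivlMr// => h'.
by apply: le_lt_trans h'; apply: ler_wpM2l => //; lra.
Qed.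

Lemma llim_mul_locally_constant (D : set R) (f g : R -> R) t l c (eta : R) : 0 < eta ->
  llim D f t l -> (forall u, t - eta < u < t -> g u = c) ->
  llim D (fun u => f u * g u) t (l * c).
Proof.
move=> eta0 h gc e e0.
have c1 : 0 < `|c| + 1 by rewrite ltr_wpDl.
have [eta' [eta'0 H]] := h (e / (`|c| + 1)) (divr_gt0 e0 c1).
exists (Num.min eta eta'); split; first by rewrite lt_min eta0.
move=> x Dx /andP[]; rewrite ltrBlDr -ltrBlDl lt_min => /andP[x1 x2] xt.
rewrite gc ?xt ?andbT 1?ltrBlDr -?ltrBlDl// -mulrBl normrM.
have := H x Dx; rewrite xt andbT ltrBlDr -ltrBlDl => /(_ x2); rewrite ltr_pdivlMr// => h'.
by apply: le_lt_trans h'; apply: ler_wpM2l => //; lra.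
Qed.

Lemma mark_event_rlim (X : R -> O -> R) w s t l : rlim setT (X ^~ w) t l ->
  rlim setT (fun u => X u w * \1_(mark_event s u) w) t (l * \1_(mark_event s t) w).
Proof.
move=> h; have [rw|nr] := pselect (regular w).
  have [eta [eta0 H]] := mark_event_right s t rw.
  apply: (rlim_mul_locally_constant eta0 h) => u /andP[tu ut]; apply: indicP; apply: H.
  by rewrite (ltW tu).
(* Off [regular] the indicator is zero at all times, so any neighbourhood serves. *)
apply: (rlim_mul_locally_constant ltr01 h) => u _; apply: indicP; by split => -[].
Qed.

Lemma mark_event_llim (X : R -> O -> R) w s t l : llim setT (X ^~ w) t l ->
  llim setT (fun u => X u w * \1_(mark_event s u) w) t (l * \1_(mark_event_left s t) w).
Proof.
move=> h; have [rw|nr] := pselect (regular w).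
  have [eta [eta0 H]] := mark_event_leftP s t rw.
  by apply: (llim_mul_locally_constant eta0 h) => u ut; apply: indicP; exact: H.
apply: (llim_mul_locally_constant ltr01 h) => u _; apply: indicP; by split => -[].
Qed.

End JumpTimes.

Section OneSidedLimits.
Context {R : realType}.
Implicit Types (D : set R) (f g : R -> R).

Lemma rlim_ge D f (t u l e : R) : dense_set D -> rlim D f t l -> t < u ->
  (forall x, D x -> t < x < u -> e <= f x) -> e <= l.
Proof.
move=> dD h tu H; rewrite leNgt; apply/negP => le.
have [eta [eta0 h']] := h (e - l) ltac:(by rewrite subr_gt0).
have m : t < Num.min u (t + eta) by rewrite lt_min tu ltrDl.
have [x [Dx /andP[tx]]] := dD _ _ m; rewrite lt_min => /andP[xu xe].
have := h' x Dx; rewrite tx xe => /(_ isT); have := H x Dx; rewrite tx xu => /(_ isT) ex.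
by rewrite ltr_norml => /andP[_]; lra.
Qed.

Lemma llim_ge D f (t u l e : R) : dense_set D -> llim D f t l -> u < t ->
  (forall x, D x -> u < x < t -> e <= f x) -> e <= l.
Proof.
move=> dD h tu H; rewrite leNgt; apply/negP => le.
have [eta [eta0 h']] := h (e - l) ltac:(by rewrite subr_gt0).
have m : Num.max u (t - eta) < t by rewrite gt_max tu/= ltrBlDr ltrDl.
have [x [Dx /andP[]]] := dD _ _ m; rewrite gt_max => /andP[xu xe] tx.
have := h' x Dx; rewrite tx xe => /(_ isT); have := H x Dx; rewrite tx xu => /(_ isT) ex.
by rewrite ltr_norml => /andP[_]; lra.
Qed.

Lemma rlim_near f g (t eta l : R) : 0 < eta -> (forall u, t < u < t + eta -> f u = g u) ->
  rlim setT f t l -> rlim setT g t l.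
Proof.
move=> eta0 fg h e e0; have [eta' [eta'0 H]] := h e e0.
exists (Num.min eta eta'); split; first by rewrite lt_min eta0.
move=> x _ /andP[tx]; rewrite -ltrBlDl lt_min => /andP[x1 x2].
by rewrite -fg ?H// tx -ltrBlDl.
Qed.

Lemma llim_near f g (t eta l : R) : 0 < eta -> (forall u, t - eta < u < t -> f u = g u) ->
  llim setT f t l -> llim setT g t l.
Proof.
move=> eta0 fg h e e0; have [eta' [eta'0 H]] := h e e0.
exists (Num.min eta eta'); split; first by rewrite lt_min eta0.
move=> x _ /andP[]; rewrite ltrBlDr -ltrBlDl lt_min => /andP[x1 x2] xt.
by rewrite -fg ?H// xt andbT ltrBlDr -ltrBlDl.
Qed.

Lemma rlim_div f g (t l m : R) : m != 0 -> rlim setT f t l -> rlim setT g t m ->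
  rlim setT (fun u => f u / g u) t (l / m).
Proof. by move=> m0 /rlimP h1 /rlimP h2; apply/rlimP; apply: cvgM => //; exact: cvgV. Qed.

Lemma llim_div f g (t l m : R) : m != 0 -> llim setT f t l -> llim setT g t m ->
  llim setT (fun u => f u / g u) t (l / m).
Proof. by move=> m0 /llimP h1 /llimP h2; apply/llimP; apply: cvgM => //; exact: cvgV. Qed.

End OneSidedLimits.

Section Codes.

(** Membership fixes a list only up to order and repetition. Choosing it from the predicate makes
    the code a function of the set of active pieces, hence constant as long as that set is; [[::]]
    is the value for infinite sets. *)
Definition index_code (p : nat -> Prop) : seq nat :=
  xget [::] [set s : seq nat | forall i, p i <-> i \in s].

Lemma index_codeP (p : nat -> Prop) : (exists s : seq nat, forall i, p i <-> i \in s) ->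
  forall i, p i <-> i \in index_code p.
Proof. exact: (@xgetPex _ _ [set s : seq nat | forall i, p i <-> i \in s]). Qed.

Lemma eq_index_code (p q : nat -> Prop) : (forall i, p i <-> q i) -> index_code p = index_code q.
Proof. by move=> pq; have -> : p = q by apply/funext => i; exact/propext. Qed.

End Codes.

(** * Numerators and denominators for a fixed active set *)

Section MarkedConditioning.
Context {R : realType} d dE (O : measurableType d) (E : measurableType dE).
Variable P : probability O R.
Hypothesis Pc : measure_is_complete P.
Variables (T : nat -> O -> \bar R) (Z : nat -> O -> E).
Hypothesis mT : forall i, measurable_fun setT (T i).
Hypothesis mZ : forall i, measurable_fun setT (Z i).
Hypothesis T_count : forall t : R, 0 <= t ->
  (\int[P]_w (\sum_(0 <= i <oo) ((T i w <= t%:E)%E%:R)%:E) < +oo)%E.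
Local Notation Int f := (P.-integrable setT (EFin \o f)).
Local Notation H s := (<<s mark_gen P Z s >>).
Local Notation A := (mark_event T).
Local Notation AL := (mark_event_left T).

Let HM s : mark_gen P Z s `<=` measurable.
Proof. exact: mark_gen_measurable. Qed.

Let HN s : null_sets P `<=` H s.
Proof. exact: mark_gen_null. Qed.

Lemma measurable_mark_event s t : measurable (A s t).
Proof.
apply: (@measurable_active_set _ _ _ _ _ P _ Z);
  [|exact: mZ|exact: (measurable_regular mT)|exact: (regular_full mT T_count)].
by move=> i; exact: measurable_present.
Qed.

Section Process.
Variables (X : R -> O -> R) (S : nat -> O -> R).
Hypothesis mX : forall t, 0 <= t -> measurable_fun setT (X t).
Hypothesis cX : forall w, cadlag (X ^~ w).
Hypothesis iS : forall n, Int (S n).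
Hypothesis S0 : forall n w, 0 <= S n w.
Hypothesis XS : {ae P, forall w, forall n t, 0 <= t <= n%:R -> `|X t w| <= S n w}.

Lemma measurable_left_lim t : 0 < t -> measurable_fun setT (fun w => left_lim (X ^~ w) t).
Proof.
move=> t0; have [u hu] := rational_seq_left t0.
apply: (@measurable_fun_cvg _ _ _ setT (fun k => X (u k))).
  by move=> k; apply: mX; have [_ /ltW] := hu k.
move=> w _; have /cadlagP[_ h] := cX w; apply: (llim_seq (h t t0)) => k; split => //.
by have [] := hu k.
Qed.

Lemma integrable_left_lim t : 0 < t -> Int (fun w => left_lim (X ^~ w) t).
Proof.
move=> t0; have [u hu] := rational_seq_left t0.
apply: (ae_le_integrable (measurable_left_lim t0) (iS (Num.truncn t).+1)).
apply: filterS XS => w XSw; have /cadlagP[_ /(_ t t0) h] := cX w.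
have cv : X (u k) w @[k --> \oo] --> left_lim (X ^~ w) t.
  by apply: (llim_seq h) => k; split => //; have [] := hu k.
have cv' : `|X (u k) w| @[k --> \oo] --> `|left_lim (X ^~ w) t| by exact: cvg_norm.
rewrite -(cvg_lim _ cv')//; apply: limr_le; first by apply/cvg_ex; eexists; exact: cv'.
apply: nearW => k; apply: XSw; have [_ /ltW-> /andP[_ ut]] := hu k.
by rewrite /= ltW// (lt_trans ut)// truncnS_gt.
Qed.

(** The product of [X] with the indicator of [A s t] is càdlàg and still dominated by [S].
    Conditioning takes place on [H s], fixed in time, so [cond_exp_cadlag] applies; the left limit
    of the indicator is that of [AL s t]. *)
Lemma marked_cond_exp : exists N : seq nat -> R -> O -> R, forall s, [/\
  forall w, cadlag (N s ^~ w),
  forall t, 0 <= t -> is_cond_exp P (H s) (fun w => X t w * \1_(A s t) w) (N s t) &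
  forall t, 0 < t -> is_cond_exp P (H s) (fun w => left_lim (X ^~ w) t * \1_(AL s t) w)
    (fun w => left_lim (N s ^~ w) t)].
Proof.
suff h : forall s, exists N : R -> O -> R, [/\
  forall w, cadlag (N ^~ w),
  forall t, 0 <= t -> is_cond_exp P (H s) (fun w => X t w * \1_(A s t) w) (N t) &
  forall t, 0 < t -> is_cond_exp P (H s) (fun w => left_lim (X ^~ w) t * \1_(AL s t) w)
    (fun w => left_lim (N ^~ w) t)] by have [N hN] := choice h; exists N.
move=> s; pose xi t w := X t w * \1_(A s t) w.
have xil w t : 0 < t -> llim setT (xi ^~ w) t (left_lim (X ^~ w) t * \1_(AL s t) w).
  by move=> t0; apply: mark_event_llim; have /cadlagP[_] := cX w; exact.
have mxi t : 0 <= t -> measurable_fun setT (xi t).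
  move=> t0; apply: measurable_funM; first exact: mX.
  by apply: measurable_indic; exact: measurable_mark_event.
have cxi w : cadlag (xi ^~ w).
  apply/cadlagP; split => t t0.
    by apply: mark_event_rlim; have /cadlagP[+ _] := cX w; exact.
  by rewrite (left_limE (xil w t t0)); exact: xil.
have xiS : {ae P, forall w, forall n t, 0 <= t <= n%:R -> `|xi t w| <= S n w}.
  apply: filterS XS => w h n t tn; apply: le_trans (h n t tn).
  by rewrite /xi indicE; case: (_ \in _); rewrite ?mulr1 ?mulr0 ?normr0.
have [N [cN h1 h2]] := cond_exp_cadlag (@HM s) Pc (@HN s) mxi cxi iS S0 xiS.
exists N; split => // t t0; have := h2 t t0.
by congr (is_cond_exp _ _ _ _); apply/funext => w; rewrite (left_limE (xil w t t0)).
Qed.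

(** The indicator changes only when the jump count does, so the variation of the product is at most
    that of [X] plus [C] times the number of jumps, with integrable bound [V n + C * J n]. *)
Lemma marked_bounded_variation (N : seq nat -> R -> O -> R) (C : R) (V : nat -> O -> R) :
  (forall s w, cadlag (N s ^~ w)) ->
  (forall s t, 0 <= t -> is_cond_exp P (H s) (fun w => X t w * \1_(A s t) w) (N s t)) ->
  0 <= C -> (forall t w, 0 <= t -> `|X t w| <= C) -> (forall n, Int (V n)) ->
  {ae P, forall w, forall n (x : R) r, (forall y, y \in x :: r -> rationals y) ->
     path <=%R x r -> (forall y, y \in x :: r -> 0 <= y <= n%:R) ->
     tvar 0 (X ^~ w) x r <= V n w} ->
  {ae P, forall w, forall s, forall n : nat, exists K, tvb 0 (N s ^~ w) `[0, n%:R] K}.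
Proof.
move=> cN cXN C0 XC iV XV; apply: ae_countable => s.
pose J n w := fine (jump_count T n%:R w).
have iJ n : Int (J n).
  apply: (@le_integrable _ _ _ _ _ _ _ (jump_count T n%:R)) => //.
  - apply/measurable_EFinP; apply: measurableT_comp => //; exact: measurable_jump_count.
  - move=> w _; rewrite /= gee0_abs ?jump_count_ge0// ger0_norm ?fine_ge0 ?jump_count_ge0//.
    by rewrite /J; move: (jump_count_ge0 T n%:R w); case: (jump_count _ _ _) => [r| |] //= _; rewrite leey.
  - exact: integrable_jump_count.
have iX t (t0 : 0 <= t) : Int (fun w => X t w * \1_(A s t) w).
  apply: integrable_indic_mul; first exact: measurable_mark_event.
  exact: (process_integrable mX iS XS).
apply: (@cond_exp_bounded_variation _ _ _ P _ (@HM s)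
  (fun t w => X t w * \1_(A s t) w) (N s) (fun n w => V n w + C * J n w)) => //.
- exact: cXN.
- by move=> n; apply: integrable_fun_add => //; exact: integrable_fun_scale.
apply: filterS2 XV (regular_ae mT T_count) => w XVw rw n x r rr pr xr.
have jm a b : a <= b -> fine (jump_count T a w) <= fine (jump_count T b w).
  by move=> ab; rewrite fine_le ?jump_count_fin ?jump_count_le.
have := @tvar0_comb R (fun y => 0 <= y) (X ^~ w) (fun t => fine (jump_count T t w))
  (fun t => X t w * \1_(A s t) w) 1 C x r _ pr _.
rewrite mul1r => h; apply: (le_trans (h _ _)).
- move=> a b a0 b0 ab.
  have -> : X b w * \1_(A s b) w - X a w * \1_(A s a) w =
    \1_(A s b) w * (X b w - X a w) + X a w * (\1_(A s b) w - \1_(A s a) w) by ring.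
  apply: (le_trans (ler_normD _ _)); rewrite !normrM; apply: lerD.
    by apply: ler_wpM2r => //; rewrite indicE; case: (_ \in _); rewrite ?normr1 ?normr0.
  apply: ler_pM => //; first exact: XC.
  by apply: (le_trans (mark_event_variation s rw ab)); exact: ler_norm.
- by move=> y /xr /andP[].
apply: lerD; first exact: XVw.
apply: ler_wpM2l => //.
rewrite (@tvar0_nondecreasing R (fun => True) (fun t => fine (jump_count T t w)))//; last first.
  by move=> a b _ _; exact: jm.
rewrite lerBlDr (le_trans (jm _ n%:R _)) ?lerDl ?fine_ge0 ?jump_count_ge0//.
by have /andP[] := xr _ (mem_last x r).
Qed.

End Process.

(** A rational [q] is picked in a one-sided neighbourhood of [t] where the active set is constant.
    All rationals between [q] and [t] then share one bound [e], which right-continuity carries to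
    real times. *)
Lemma mark_event_lower_bound (D : seq nat -> R -> O -> R) :
  (forall s w, cadlag (D s ^~ w)) ->
  (forall s t, 0 <= t -> is_cond_exp P (H s) (\1_(A s t)) (D s t)) ->
  {ae P, forall w, regular T w /\ forall s,
    (forall t, 0 <= t -> A s t w -> exists eta e : R, [/\ 0 < eta, 0 < e &
       forall u, t <= u < t + eta -> e <= D s u w]) /\
    (forall t, 0 < t -> AL s t w -> exists eta e : R, [/\ 0 < eta, 0 < e &
       forall u, t - eta < u < t -> e <= D s u w])}.
Proof.
move=> cD cAD.
have h : {ae P, forall w, forall s, forall q : R, rationals q -> 0 <= q -> exists e, 0 < e /\
    forall r, rationals r -> 0 <= r ->
    (forall v, rationals v -> q <= v <= r \/ r <= v <= q -> A s v w) -> e <= D s r w}.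
  apply: ae_countable => s.
  apply: (cond_prob_locally_bounded_below (@HM s)) => t t0; [exact: measurable_mark_event|exact: cAD].
apply: filterS2 (regular_ae mT T_count) h => w rw hw; split => // s.
have /cadlagP[rc _] := cD s w.
split => t t0 At.
- have [eta [eta0 Heta]] := mark_event_right s t rw.
  have tt : t < t + eta by rewrite ltrDl.
  have [q [rq /andP[tq qt]]] := dense_rationals tt.
  have [e [e0 He]] := hw s q rq (le_trans t0 (ltW tq)).
  exists (q - t), e; split; [by rewrite subr_gt0|by []|] => u /andP[tu]; rewrite subrKC => uq.
  have u0 : 0 <= u := le_trans t0 tu.
  apply: (rlim_ge dense_rationals (rlim_sub (@subsetT _ _) (rc u u0)) uq) => r rr /andP[ur rq'].
  apply: He => //; first exact: le_trans u0 (ltW ur).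
  move=> v rv [|] /andP[v1 v2].
    by have := lt_le_trans rq' v1; rewrite ltNge v2.
  apply/Heta => //; rewrite (le_trans tu (le_trans (ltW ur) v1))/=.
  exact: le_lt_trans v2 qt.
- have [eta [eta0 Heta]] := mark_event_leftP s t rw.
  have mt : Num.max 0 (t - eta) < t by rewrite gt_max t0/= ltrBlDr ltrDl.
  have [q [rq /andP[+ qt]]] := dense_rationals mt; rewrite gt_max => /andP[q0 qe].
  have [e [e0 He]] := hw s q rq (ltW q0).
  exists (t - q), e; split; [by rewrite subr_gt0|by []|] => u; rewrite subKr => /andP[qu ut].
  have u0 : 0 <= u := ltW (lt_trans q0 qu).
  apply: (rlim_ge dense_rationals (rlim_sub (@subsetT _ _) (rc u u0)) ut) => r rr /andP[ur rt].
  apply: He => //; first exact: le_trans u0 (ltW ur).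
  move=> v rv [|] /andP[v1 v2]; last first.
    by have := lt_trans qu ur; rewrite ltNge (le_trans v1 v2).
  apply/Heta => //; rewrite (lt_le_trans qe v1)/=.
  exact: le_lt_trans v2 rt.
Qed.


End MarkedConditioning.

Unset Implicit Arguments. Set Strict Implicit. Set Printing Implicit Defensive.

Theorem mainTheorem1 (R : realType) (d : measure_display) (Omega : measurableType d)
  (P : probability Omega R) (dE : measure_display) (E : measurableType dE)
  (T : nat -> Omega -> \bar R) (Z : nat -> Omega -> E)
  (hOmega : polish_completed_space P)
  (hPcomplete : measure_is_complete P)
  (hE : @polish_borel_space R _ E)
  (hTmeas : forall i, measurable_fun setT (T i))
  (hTnonneg : forall i w, (0 <= T i w)%E)
  (hZmeas : forall i, measurable_fun setT (Z i))
  (hZpair : forall i, Z i.*2 = Z i.*2.+1)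
  (hTle : forall i w, (T i.*2 w <= T i.*2.+1 w)%E)
  (hTlt : forall i w, (T i.*2.+1 w < +oo)%E -> (T i.*2 w < T i.*2.+1 w)%E)
  (hcount : forall t : R, 0 <= t ->
     (\int[P]_w (\sum_(0 <= i <oo) ((T i w <= t%:E)%E%:R)%:E) < +oo)%E)
  (X : R -> Omega -> R)
  (hXmeas : forall t, 0 <= t -> measurable_fun setT (X t))
  (hXcadlag : forall w, cadlag (X ^~ w))
  (hXint : forall t, 0 <= t ->
     (\int[P]_w ereal_sup ((fun s : R => (`|X s w|)%:E) @` `[0%R, t]) < +oo)%E) :
  exists XG : R -> Omega -> R,
    [/\ (forall w, cadlag (XG ^~ w)) /\
          (forall t, 0 <= t -> measurable_fun setT (XG t)),
        (forall t, 0 <= t -> exists Y, is_cond_exp P (Ginfo P T Z t) (X t) Y /\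
              {ae P, forall w, XG t w = Y w}),
        (forall XG' : R -> Omega -> R,
            (forall w, cadlag (XG' ^~ w)) ->
            (forall t, 0 <= t -> exists Y, is_cond_exp P (Ginfo P T Z t) (X t) Y /\
               {ae P, forall w, XG' t w = Y w}) ->
            {ae P, forall w, (forall t, 0 <= t -> XG t w = XG' t w)}),
        (forall t, 0 < t -> exists Y,
              is_cond_exp P (Ginfo_minus P T Z t) (fun w => left_lim (X ^~ w) t) Y /\
              {ae P, forall w, left_lim (XG ^~ w) t = Y w}) &
        ((exists C : R, forall t w, 0 <= t -> `|X t w| <= C) ->
         (forall t, 0 <= t -> (\int[P]_w total_variation 0 t (X ^~ w) < +oo)%E) ->
         {ae P, forall w, (forall t, 0 <= t ->
              (total_variation 0 t (XG ^~ w) < +oo)%E)})].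
Proof.

(* Setup and integrable domination of the paths *)
pose Z' i := Z i.*2.+1.
have mZ' i : measurable_fun setT (Z' i) by exact: hZmeas.
pose H s := mark_gen P Z' s.
have HM s : H s `<=` measurable by exact: mark_gen_measurable.
have mreg : measurable (regular T) by exact: measurable_regular.
have freg : P (~` regular T) = 0%E by exact: regular_full.
have GM t : info_gen P (present T t) Z' `<=` measurable.
  by apply: info_gen_measurable => // i; exact: measurable_present.
have GMm t : info_gen P (present_left T t) Z' `<=` measurable.
  by apply: info_gen_measurable => // i; exact: measurable_present_left.
have [u [hu us]] := rational_enum (R := R).
have /choice[S0 hS0] : forall n : nat, exists V : Omega -> R, [/\ P.-integrable setT (EFin \o V),
    forall w, 0 <= V w & {ae P, forall w, forall j, (if u j <= n%:R then `|X (u j) w| else 0) <= V w}].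
  move=> n; apply: (@dominating_integrable _ _ _ P nat (fun j w => if u j <= n%:R then `|X (u j) w| else 0)
    (fun w => ereal_sup ((fun s : R => (`|X s w|)%:E) @` `[0%R, n%:R]))).
  - move=> j; have [_|_] := boolP (u j <= n%:R) => //.
    by apply: measurableT_comp => //; apply: hXmeas; have [] := hu j.
  - by move=> j w; case: ifP.
  - have up w : (0 <= ereal_sup [set `|X s w|%:E | s in `[0%R, n%:R]])%E.
      apply: (@le_trans _ _ (`|X 0 w|%:E)); first by rewrite lee_fin.
      by apply: ereal_sup_ubound; exists 0; rewrite //= in_itv/= lexx ler0n.
    move=> j w; case: ifP => [un|_]; last exact: up.
    by apply: ereal_sup_ubound; exists (u j); rewrite //= in_itv/= un andbT; have [] := hu j.
  - move=> w; apply: (@le_trans _ _ (`|X 0 w|%:E)); first by rewrite lee_fin.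
    by apply: ereal_sup_ubound; exists 0; rewrite //= in_itv/= lexx ler0n.
  - exact: hXint.
(* [S0] dominates rational times only. Real times up to [n] are approached by rationals from the
   right, which stay below [n.+1]. *)
pose S n := S0 n.+1.
have iS n : P.-integrable setT (EFin \o S n) by have [] := hS0 n.+1.
have S_ge0 n w : 0 <= S n w by have [_ + _] := hS0 n.+1; exact.
have XS : {ae P, forall w, forall n t, 0 <= t <= n%:R -> `|X t w| <= S n w}.
  have hb : {ae P, forall w, forall n j, (if u j <= n.+1%:R then `|X (u j) w| else 0) <= S n w}.
    by apply: ae_foralln => n; have [_ _] := hS0 n.+1; exact.
  apply: filterS hb => w hw n t /andP[t0 tn].
  have /cadlagP[/(_ t t0) rc _] := hXcadlag w.
  have [v hv] := rational_seq_right t.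
  have cv : `|X (v k) w| @[k --> \oo] --> `|X t w|.
    by apply: cvg_norm; apply: (rlim_seq rc) => k; split => //; have [] := hv k.
  rewrite -(cvg_lim _ cv)//; apply: limr_le; first by apply/cvg_ex; eexists; exact: cv.
  apply: nearW => k; have [rv /andP[tv vt]] := hv k.
  have [j uj] := us (v k) rv (le_trans t0 (ltW tv)).
  have vn : v k <= n.+1%:R.
    apply: (le_trans (ltW vt)); rewrite -[n.+1%:R]natr1; apply: lerD => //.
    by rewrite invf_le1// ler1n.
  by have := hw n j; rewrite uj vn.
have iX t (t0 : 0 <= t) : P.-integrable setT (EFin \o X t) := process_integrable hXmeas iS XS t0.

(* Numerators, denominators and the quotient process *)
have [N hN] := marked_cond_exp hPcomplete hTmeas mZ' hcount hXmeas hXcadlag iS S_ge0 XS.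
have c1 (w : Omega) : cadlag ((fun (_ : R) (_ : Omega) => 1 : R) ^~ w).
  by split => t _; [exact: cvg_cst|exact: is_cvg_cst].
have i1 (n : nat) : P.-integrable setT (EFin \o (fun _ : Omega => 1 : R)) := integrable_fun_cst P 1.
have b1 : {ae P, forall w : Omega, forall (n : nat) (t : R), 0 <= t <= n%:R -> `|1 : R| <= 1}.
  by apply: aeW => w n t _; rewrite normr1.
(* The denominators are the numerators of the constant process [1]. *)
have [D hD] := marked_cond_exp hPcomplete hTmeas mZ' hcount
  (fun t _ => measurable_cst (1 : R)) c1 i1 (fun _ _ => ler01) b1.
have cN s w : cadlag (N s ^~ w) by case: (hN s).
have cD s w : cadlag (D s ^~ w) by case: (hD s).
have cAD s t (t0 : 0 <= t) : is_cond_exp P <<s H s >> (\1_(mark_event T s t)) (D s t).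
  case: (hD s) => _ /(_ t t0) + _; congr (is_cond_exp _ _ _ _).
  by apply/funext => w; rewrite mul1r.
have cALD s t (t0 : 0 < t) :
    is_cond_exp P <<s H s >> (\1_(mark_event_left T s t)) (fun w => left_lim (D s ^~ w) t).
  case: (hD s) => _ _ /(_ t t0); congr (is_cond_exp _ _ _ _).
  apply/funext => w; rewrite (_ : left_lim _ t = 1) ?mul1r//.
  by apply: left_limE; apply/llimP; exact: cvg_cst.
pose good w := regular T w /\ forall s,
  (forall t, 0 <= t -> mark_event T s t w -> exists eta e : R, [/\ 0 < eta, 0 < e &
       forall u, t <= u < t + eta -> e <= D s u w]) /\
  (forall t, 0 < t -> mark_event_left T s t w -> exists eta e : R, [/\ 0 < eta, 0 < e &
       forall u, t - eta < u < t -> e <= D s u w]).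
have good_ae : {ae P, forall w, good w}.
  exact: (mark_event_lower_bound hTmeas mZ' hcount cD cAD).
pose cr t w := index_code (fun i => present T t i w).
pose cl t w := index_code (fun i => present_left T t i w).
have crP t w : regular T w -> mark_event T (cr t w) t w.
  by move=> rw; split => //; apply: index_codeP; exact: present_code.
have clP t w : regular T w -> mark_event_left T (cl t w) t w.
  by move=> rw; split => //; apply: index_codeP; exact: present_left_code.
(* The value zero off [good] makes every path càdlàg and changes the process on a null set only. *)
pose XG t w := if `[< good w >] then N (cr t w) t w / D (cr t w) t w else 0.
have XGr w t : good w -> 0 <= t -> exists eta e : R, [/\ 0 < eta, 0 < e &
    forall u, t <= u < t + eta ->
      XG u w = N (cr t w) u w / D (cr t w) u w /\ e <= D (cr t w) u w].
  move=> gw t0; have [rw /(_ (cr t w))[/(_ t t0 (crP t w rw)) [eta [e [eta0 e0 He]]] _]] := gw.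
  have [eta' [eta'0 H']] := present_right t rw.
  exists (Num.min eta eta'), e; split => //; first by rewrite lt_min eta0.
  move=> v /andP[tv]; rewrite -ltrBlDl lt_min => /andP[v1 v2]; split.
    rewrite /XG asboolT// (_ : cr v w = cr t w)//.
    by apply: eq_index_code; apply: H'; rewrite tv -ltrBlDl.
  by apply: He; rewrite tv -ltrBlDl.
have XGl w t : good w -> 0 < t -> exists eta e : R, [/\ 0 < eta, 0 < e &
    forall u, t - eta < u < t ->
      XG u w = N (cl t w) u w / D (cl t w) u w /\ e <= D (cl t w) u w].
  move=> gw t0; have [rw /(_ (cl t w))[_ /(_ t t0 (clP t w rw)) [eta [e [eta0 e0 He]]]]] := gw.
  have [eta' [eta'0 H']] := present_leftP t rw.
  exists (Num.min eta eta'), e; split => //; first by rewrite lt_min eta0.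
  move=> v /andP[]; rewrite ltrBlDr -ltrBlDl lt_min => /andP[v1 v2] vt; split.
    rewrite /XG asboolT// (_ : cr v w = cl t w)//.
    by apply: eq_index_code; apply: H'; rewrite vt andbT ltrBlDr -ltrBlDl.
  by apply: He; rewrite vt andbT ltrBlDr -ltrBlDl.
have XGll w t : good w -> 0 < t ->
    llim setT (XG ^~ w) t (left_lim (N (cl t w) ^~ w) t / left_lim (D (cl t w) ^~ w) t).
  move=> gw t0; have [eta [e [eta0 e0 He]]] := XGl w t gw t0.
  have /cadlagP[_ /(_ t t0) lN] := cN (cl t w) w.
  have /cadlagP[_ /(_ t t0) lD] := cD (cl t w) w.
  (* The lower bound survives in the left limit, so the left limit of the quotient is the quotient
     of the left limits. *)
  have De : e <= left_lim (D (cl t w) ^~ w) t.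
    apply: (llim_ge dense_rationals (llim_sub (@subsetT _ _) lD) (u := t - eta)).
      by rewrite ltrBlDr ltrDl.
    by move=> x _ xt; have [] := He x xt.
  apply: (llim_near eta0 _ (llim_div _ lN lD)); first by move=> v /He[].
  by rewrite gt_eqF// (lt_le_trans e0).
have cXG w : cadlag (XG ^~ w).
  have [gw|ngw] := pselect (good w); last first.
    have -> : XG ^~ w = cst 0 by apply/funext => t; rewrite /XG asboolF.
    by split => t _; [exact: cvg_cst|exact: is_cvg_cst].
  apply/cadlagP; split => t t0; last by rewrite (left_limE (XGll w t gw t0)); exact: XGll.
  have [eta [e [eta0 e0 He]]] := XGr w t gw t0.
  have tt : t <= t < t + eta by rewrite lexx ltrDl.
  have [-> De] := He t tt.
  have /cadlagP[/(_ t t0) rN _] := cN (cr t w) w.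
  have /cadlagP[/(_ t t0) rD _] := cD (cr t w) w.
  apply: (rlim_near eta0 _ (rlim_div _ rN rD)).
    by move=> v /andP[/ltW tv vt]; have [] := He v ltac:(by rewrite tv vt).
  by rewrite gt_eqF// (lt_le_trans e0).

(* Identification with the conditional expectations *)
have projG t : 0 <= t -> exists Y, is_cond_exp P (Ginfo P T Z t) (X t) Y /\
    {ae P, forall w, XG t w = Y w}.
  move=> t0; have [Y cY] := cond_exp_exists (GM t) (iX t t0).
  exists Y; split => //.
  (* There are countably many lists [s], so off one null set the formula holds for all of them, in
     particular for the random code [cr t w]. *)
  have tr : {ae P, forall w, forall s : seq nat, mark_event T s t w -> Y w = N s t w / D s t w}.
    apply: ae_countable => s.
    apply: (@trace_cond_exp _ _ _ _ _ P hPcomplete (present T t) Z' (regular T) _ mZ' mreg freg s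
      (X t)) => //.
    - by move=> i; exact: measurable_present.
    - exact: iX.
    - by case: (hN s) => _ + _; exact.
    - exact: cAD.
  apply: filterS2 good_ae tr => w gw h; have [rw _] := gw.
  by rewrite /XG asboolT// (h _ (crP t w rw)).
have projGm t : 0 < t -> exists Y,
    is_cond_exp P (Ginfo_minus P T Z t) (fun w => left_lim (X ^~ w) t) Y /\
    {ae P, forall w, left_lim (XG ^~ w) t = Y w}.
  move=> t0; have iXl := integrable_left_lim hXmeas hXcadlag iS XS t0.
  have [Y cY] := cond_exp_exists (GMm t) iXl.
  exists Y; split => //.
  have tr : {ae P, forall w, forall s : seq nat, mark_event_left T s t w ->
      Y w = left_lim (N s ^~ w) t / left_lim (D s ^~ w) t}.
    apply: ae_countable => s.
    apply: (@trace_cond_exp _ _ _ _ _ P hPcomplete (present_left T t) Z' (regular T) _ mZ' mreg freg s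
      (fun w => left_lim (X ^~ w) t) Y (fun w => left_lim (N s ^~ w) t) (fun w => left_lim (D s ^~ w) t)) => //.
    - by move=> i; exact: measurable_present_left.
    - by case: (hN s) => _ _; exact.
    - exact: cALD.
  apply: filterS2 good_ae tr => w gw h; have [rw _] := gw.
  by rewrite (left_limE (XGll w t gw t0)) (h _ (clP t w rw)).
exists XG; split => //.
- split => // t t0; have [Y [cY YE]] := projG t t0.
  apply: (ae_measurable_fun hPcomplete (Y := Y)).
    by apply: integrable_EFin_fun; case: cY => _ + _; exact.
  by apply: filterS YE => w ->.

(* Uniqueness up to evanescence *)
- move=> XG' cXG' hXG'.
  have eqQ : {ae P, forall w, forall j, XG (u j) w = XG' (u j) w}.
    apply: ae_foralln => j; have [_ uj0] := hu j.
    have [Y [cY YE]] := projG _ uj0; have [Y' [cY' YE']] := hXG' _ uj0.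
    have := cond_exp_unique (GM (u j)) cY cY'.
    by apply: filterS3 YE YE' => w -> -> ->.
  apply: filterS eqQ => w eqw t t0.
  have /cadlagP[/(_ t t0) r1 _] := cXG w; have /cadlagP[/(_ t t0) r2 _] := cXG' w.
  apply: (rlim_unique dense_rationals (rlim_sub (@subsetT _ _) r1)).
  move=> e e0; have [eta [eta0 He]] := r2 e e0; exists eta; split => // x rx /andP[tx xt].
  have [j xj] := us x rx (le_trans t0 (ltW tx)).
  by rewrite -xj eqw xj; apply: He => //; rewrite tx.

(* Finite variation *)
- move=> [C XC] hTV.
  have C0 : 0 <= `|C| by [].
  have XC' t w : 0 <= t -> `|X t w| <= `|C|.
    by move=> t0; apply: (le_trans (XC t w t0)); exact: ler_norm.
  (* The domination lemma is applied to the countable family of lists of rationals; a list that is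
     not a nondecreasing chain in [[0, n]] contributes zero. *)
  have /choice[V hV] : forall n : nat, exists V : Omega -> R, [/\ P.-integrable setT (EFin \o V),
      forall w, 0 <= V w & {ae P, forall w, forall q : seq rat,
        (if [&& q != [::], path <=%R (head 0 (map ratr q : seq R)) (behead (map ratr q)) &
           all (fun y => 0 <= y <= n%:R) (map ratr q : seq R)]
         then tvar 0 (X ^~ w) (head 0 (map ratr q)) (behead (map ratr q)) else 0) <= V w}].
    move=> n; apply: (@dominating_integrable _ _ _ P (seq rat) (fun q w => if _ then _ else _)
      (fun w => total_variation 0 n%:R (X ^~ w))).
    - move=> [|q r] //=; set b := [&& _, _ & _]; have [/andP[_ /andP[q0 r0]]|_] := boolP b => //.
      apply: measurable_tvar => y; rewrite inE => /orP[/eqP->|/(allP r0) /andP[y0 _]]; apply: hXmeas => //.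
      by case/andP: q0.
    - by move=> q w; case: ifP => // _; exact: tvar_ge0.
    - move=> [|q r] w //=; first exact: total_variation_ge0.
      case: ifP => [/andP[pr /andP[q0 r0]]|_]; last exact: total_variation_ge0.
      apply: tvar_total_variation => //; first by case/andP: q0.
      by move=> y; rewrite inE => /orP[/eqP->//|/(allP r0)].
    - by move=> w; exact: total_variation_ge0.
    - exact: hTV.
  have XV : {ae P, forall w, forall n (x : R) r, (forall y, y \in x :: r -> rationals y) ->
     path <=%R x r -> (forall y, y \in x :: r -> 0 <= y <= n%:R) ->
     tvar 0 (X ^~ w) x r <= V n w}.
    apply: ae_foralln => n; have [_ _] := hV n; apply: filterS => w hw x r rr pr xr.
    have [[//|q s] /= [xE rE]] := rational_chain rr.
    have := hw (q :: s); rewrite /= -xE -rE pr xr ?mem_head//= ifT//.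
    by apply/allP => y yr; apply: xr; rewrite inE yr orbT.
  have iV n : P.-integrable setT (EFin \o V n) by case: (hV n).
  have NV := marked_bounded_variation hTmeas mZ' hcount hXmeas iS XS (fun s => cN s)
    (fun s => ltac:(by case: (hN s))) C0 XC' iV XV.
  (* The constant process [1] has variation zero, so the denominators are covered with [V = 0]. *)
  have DV : {ae P, forall w, forall s, forall n : nat, exists K, tvb 0 (D s ^~ w) `[0, n%:R] K}.
    apply: (marked_bounded_variation hTmeas mZ' hcount (X := fun _ _ => 1)
      (fun t _ => measurable_cst (1 : R)) i1 b1 cD _ ler01 _ (V := fun _ _ => 0)) => //.
    - by move=> s; case: (hD s).
    - by move=> t w _; rewrite normr1.
    - by move=> n; exact: integrable_fun_cst.
    - apply: aeW => w n x r _ _ _; elim: r x => [|y r IH] x //.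
      by rewrite tvar0_cons subrr normr0 add0r.
  apply: filterS3 good_ae NV DV => w gw NVw DVw t t0.
  have [K bK] : exists K, tvb 0 (XG ^~ w) `[0, t] K; last exact: tvb_total_variation t0 bK.
  apply: tvb_local_global => // v v0.
  + have [eta [e [eta0 e0 He]]] := XGr w v gw v0.
    pose n := (Num.truncn (v + eta)).+1.
    have sub : `[v, v + eta[ `<=` `[0, n%:R].
      move=> y; rewrite /= !in_itv/= => /andP[vy yv]; rewrite (le_trans v0 vy)/= ltW//.
      by rewrite (lt_trans yv)// truncnS_gt.
    have [K1 bK1] := NVw (cr v w) n; have [L bL] := DVw (cr v w) n.
    have ge y : `[v, v + eta[%classic y -> e <= D (cr v w) y w.
      by rewrite /= in_itv/= => /He[].
    have [M bM] := tvb_div e0 ge (tvb_sub sub bK1) (tvb_sub sub bL).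
    exists eta; split => //; exists M; apply: tvb_eq bM => y.
    by rewrite /= in_itv/= => /He[].
  + have [eta [e [eta0 e0 He]]] := XGl w v gw v0.
    pose n := (Num.truncn v).+1.
    (* The minimum with [v] keeps the interval in the nonnegative half-line, where the bounds on [N]
       and [D] hold. *)
    have sub : `]v - Num.min eta v, v[ `<=` `[0, n%:R] `&` `]v - eta, v[.
      move=> y; rewrite /= !in_itv/= => /andP[]; rewrite ltrBlDr -ltrBlDl lt_min => /andP[y1 y2] yv.
      split; last by rewrite yv andbT ltrBlDr -ltrBlDl.
      apply/andP; split; first by move: y2; rewrite ltrBlDr ltrDl => /ltW.
      by rewrite ltW// (lt_trans yv)// truncnS_gt.
    have sub1 := subset_trans sub (@subIsetl _ _ _).
    have [K1 bK1] := NVw (cl v w) n; have [L bL] := DVw (cl v w) n.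
    have ge y : `]v - Num.min eta v, v[%classic y -> e <= D (cl v w) y w.
      by move=> /sub[_]; rewrite /= in_itv/= => /He[].
    have [M bM] := tvb_div e0 ge (tvb_sub sub1 bK1) (tvb_sub sub1 bL).
    exists (Num.min eta v); split; first by rewrite lt_min eta0.
    exists M; apply: tvb_eq bM => y /sub[_].
    by rewrite /= in_itv/= => /He[].
Qed.
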